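(* Let $\Delta^+$ be the set of positive roots of a simple root system of arbitrary type ($A_n$, $B_n$, $C_n$, $D_n$, $E_6$, $E_7$, $E_8$, $F_4$ or $G_2$), and let $\alpha_1,\dots,\alpha_k\in\Delta^+$ be linearly dependent. Then there exist integers $a_1,\dots,a_k$ with $\sum_{i=1}^k a_i\alpha_i=0$ and such that $a_j=1$ or $a_j=-1$ for at least one index $j$.
   Context: ''Simple root system'' means an irreducible reduced finite root system of one of the listed types. *)

(* Defs.v *)
From mathcomp Require Import all_boot all_order all_algebra all_fingroup.
From mathcomp Require Import reals.

Set Implicit Arguments.
Unset Strict Implicit.
Unset Printing Implicit Defensive.

Import Order.TTheory GRing.Theory Num.Theory.
Local Open Scope ring_scope.

(* <u, v^vee> = 2 (u, v) / (v, v) *)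
Definition cartan_number (R : realType) (V : vectType R)
    (ip : {dot V for idfun}) (u v : V) : R :=
  2 * ip u v / ip v v.

Definition reflection (R : realType) (V : vectType R)
    (ip : {dot V for idfun}) (a v : V) : V :=
  v - cartan_number ip v a *: a.

(* A finite set of vectors is represented by a sequence; order and
   multiplicities in Phi are irrelevant. *)
Record root_system (R : realType) (V : vectType R)
    (ip : {dot V for idfun}) (Phi : seq V) : Prop := RootSystem {
  root_neq0 : 0 \notin Phi;
  root_span : <<Phi>>%VS = fullv;
  root_reflection : forall a b, a \in Phi -> b \in Phi ->
    reflection ip a b \in Phi;
  root_integral : forall a b, a \in Phi -> b \in Phi ->
    cartan_number ip b a \is a Num.int
}.

Definition reduced (R : realType) (V : vectType R) (Phi : seq V) : Prop :=
  forall (a : V) (c : R), a \in Phi -> c *: a \in Phi -> c = 1 \/ c = -1.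

Definition irreducible (R : realType) (V : vectType R)
    (ip : {dot V for idfun}) (Phi : seq V) : Prop :=
  Phi <> [::] /\
  ~ exists P : pred V,
      [/\ exists2 a, a \in Phi & P a,
          exists2 b, b \in Phi & ~~ P b
        & forall a b, a \in Phi -> b \in Phi -> P a -> ~~ P b -> ip a b = 0].

Definition nonneg_comb (R : realType) (V : vectType R) (n : nat)
    (S : n.-tuple V) (v : V) : Prop :=
  exists c : 'I_n -> nat, v = \sum_(i < n) tnth S i *+ c i.

Record simple_system (R : realType) (V : vectType R) (Phi : seq V) (n : nat)
    (S : n.-tuple V) : Prop := SimpleSystem {
  simple_sub : {subset S <= Phi};
  simple_basis : basis_of fullv S;
  simple_comb : forall v, v \in Phi -> nonneg_comb S v \/ nonneg_comb S (- v)
}.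

Definition positive_root (R : realType) (V : vectType R) (Phi : seq V)
    (n : nat) (S : n.-tuple V) (v : V) : Prop :=
  v \in Phi /\ nonneg_comb S v.

Inductive simple_type : Type :=
  | TypeA of nat | TypeB of nat | TypeC of nat | TypeD of nat
  | TypeE6 | TypeE7 | TypeE8 | TypeF4 | TypeG2.

Definition rank (X : simple_type) : nat :=
  match X with
  | TypeA n | TypeB n | TypeC n | TypeD n => n
  | TypeE6 => 6 | TypeE7 => 7 | TypeE8 => 8 | TypeF4 => 4 | TypeG2 => 2
  end%N.

Definition valid_type (X : simple_type) : bool :=
  match X with
  | TypeA n => 1 <= n
  | TypeB n => 2 <= n
  | TypeC n => 3 <= n
  | TypeD n => 4 <= n
  | _ => true
  end%N.

Definition chain (i j : nat) : bool := (j == i.+1) || (i == j.+1).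

(* Nodes are numbered as in Bourbaki, shifted to start from 0.  The only
   off-diagonal entries other than 0 and -1 sit in the row of the long root
   and the column of the short root of a multiple bond. *)
Definition cartan_entry (X : simple_type) (i j : nat) : int :=
  let bond (b : bool) : int := if b then -1 else 0 in
  if i == j then 2 else
  match X with
  | TypeA _ => bond (chain i j)
  | TypeB n => if (i.+2 == n) && (j.+1 == n) then -2 else bond (chain i j)
  | TypeC n => if (i.+1 == n) && (j.+2 == n) then -2 else bond (chain i j)
  | TypeD n =>
      let edge k l := ((l == k.+1) && (l.+1 < n)%N)
                      || ((k.+3 == n) && (l.+1 == n)) in
      bond (edge i j || edge j i)
  | TypeE6 | TypeE7 | TypeE8 =>
      let edge k l := [|| (k == 0%N) && (l == 2%N), (k == 1%N) && (l == 3%N)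
                        | (2 <= k)%N && (l == k.+1)] in
      bond (edge i j || edge j i)
  | TypeF4 => if (i == 1%N) && (j == 2%N) then -2 else bond (chain i j)
  | TypeG2 => if (i == 1%N) && (j == 0%N) then -3 else bond (chain i j)
  end.

Definition has_type (R : realType) (V : vectType R)
    (ip : {dot V for idfun}) (X : simple_type) (S : (rank X).-tuple V) : Prop :=
  exists s : {perm 'I_(rank X)}, forall i j : 'I_(rank X),
    cartan_number ip (tnth S (s i)) (tnth S (s j)) = (cartan_entry X i j)%:~R.

(* Main.v *)
From HB Require Import structures.
Require Import Defs.
From mathcomp Require Import all_boot all_order all_algebra.
From mathcomp Require Import reals.
From mathcomp Require Import all_fingroup zify ring.
From mathcomp Require Import boolp.
Import Order.TTheory GRing.Theory Num.Theory.
Local Open Scope ring_scope.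

Set Implicit Arguments.
Unset Strict Implicit.
Unset Printing Implicit Defensive.

(** A relation with a coefficient equal to 1 or -1 is found in two different
    ways, according to the type.

    Types A, B, C, D.  In the usual coordinates every root is an integer vector
    of l1 norm at most 2: the simple roots are, and reflections in the simple
    roots act as signed permutations of the coordinates.  For integer vectors of
    l1 norm at most 2 the claim follows by contraction.  Choose a coordinate c
    and, among the vectors whose c-th entry is not 0, one vector v whose entry
    is smallest in absolute value.  Subtracting integer multiples of v kills
    the c-th entry of all the others, and does not raise l1 norms above 2
    ([l1norm_contract]).  So there is one vector less, and a relation with a
    unit coefficient among the contracted vectors lifts to one among the
    original vectors ([l1_unit_relation]).

    Types E, F, G.  The root lattice, with the form scaled so that short simple
    roots have norm 2, is an even positive definite lattice of rank at most 8,
    and roots are vectors whose reflections preserve it.  Pass to a minimal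
    dependent family alpha, so that all relations are multiples of one primitive
    relation a, and suppose that no coefficient is 1 or -1.  Replacing alpha_j
    by a root alpha_j + sum_t e_t alpha_t changes a_t into a_t - e_t a_j
    and keeps this situation, as long as no coefficient 1 or -1 appears.
    Choose (alpha, a) such that no such replacement lowers the |a_i|, and
    change signs so that a >= 0.  Two facts then finish the proof.

    - All coefficients are at most 3 ([peak_absurd]).  If f(alpha_i, alpha_j) < 0
      then alpha_i + alpha_j is a root, so minimality forces a_i and a_j to
      differ by exactly 1.  Let a_o = m >= 4 be maximal.  Pairing the relation
      with alpha_o shows that alpha_o has at least three neighbours, that is
      alpha_j with f(alpha_o, alpha_j) < 0; all have coefficient m - 1.  A
      multiple bond to one of them, two of them with positive product, or three
      of them with products at most 0 each give a root that contradicts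
      minimality; the last one is 2 alpha_o + alpha_j + alpha_l + alpha_n, the
      highest root of a D4 diagram.

    - Coefficients in {0, 2, 3} are impossible for few vectors ([low_absurd]).
      Let z be the sum of the alpha_i with a_i <> 0, and let g_i be alpha_i if
      a_i = 2 and - alpha_i if a_i = 3.  The relation says sum g_i = 5 z, and
      z - g_i is a nonzero vector of an even lattice, so it has norm at least 2.
      Summing over i gives 10 (z, z) <= sum ((z, z) + (alpha_i, alpha_i) - 2).
      With at most 9 vectors of norm 2 (type E) or 3 vectors of norm at most 6
      (type G2) this fails.  With at most 5 vectors of norm at most 4 (type F4)
      it forces (z, z) = 2 and all alpha_i long; but a sum of long roots has
      norm divisible by 4. *)

(** * Integer relations and changes of families *)

Lemma mulrz2 (L : zmodType) (x : L) : x *~ 2 = x + x.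
Proof. by rewrite -mulr2n pmulrn. Qed.

Section Relations.

Variables (I : finType) (L : zmodType).
Implicit Types (alpha : I -> L) (a b e : I -> int) (i j : I).

Definition relation alpha b : Prop := \sum_i alpha i *~ b i = 0.

(** All integer relations of [alpha] are multiples of [a].  As [a] is not 0 this
    makes [a] primitive, and [alpha] a circuit together with some vectors of
    coefficient 0 that are independent of it. *)
Definition generator alpha a : Prop :=
  [/\ relation alpha a, exists i, a i != 0
    & forall b, relation alpha b -> exists c, forall i, b i = c * a i].

(** With [e i0 = 0] the passage from [(alpha, a)] to
    [(slide alpha i0 e, slide_coef a i0 e)] is a unimodular change of the family
    and the contragredient change of its relation. *)
Definition slide alpha i0 e : I -> L :=
  fun i => alpha i + (if i == i0 then \sum_j alpha j *~ e j else 0).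

Definition slide_coef a i0 e : I -> int := fun j => a j - e j * a i0.

Lemma sum_delta alpha j : \sum_i alpha i *~ (i == j)%:Z = alpha j.
Proof.
rewrite (bigD1 j) //= eqxx mulr1z big1 ?addr0 // => i /negbTE ->.
by rewrite mulr0z.
Qed.

Lemma sum_slide alpha i0 e b :
  \sum_i slide alpha i0 e i *~ b i = \sum_j alpha j *~ (b j + e j * b i0).
Proof.
under eq_bigr do rewrite mulrzDl.
under [RHS]eq_bigr do rewrite mulrzDr mulrzA.
rewrite !big_split /= -mulrz_suml; congr (_ + _).
move: (\sum_j alpha j *~ e j) => s.
rewrite (bigD1 i0) //= eqxx big1 ?addr0 // => i /negbTE ->.
by rewrite mul0rz.
Qed.

Lemma generator_slide alpha a i0 e : e i0 = 0 ->
  generator alpha a -> generator (slide alpha i0 e) (slide_coef a i0 e).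
Proof.
move=> e0 [ra [i ai] ga]; split.
- rewrite /relation sum_slide -[RHS]ra; apply: eq_bigr => j _.
  by rewrite /slide_coef e0 mul0r subr0 subrK.
- case: (eqVneq (a i0) 0) => [a0|a0]; last first.
    by exists i0; rewrite /slide_coef e0 mul0r subr0.
  by exists i; rewrite /slide_coef a0 mulr0 subr0.
- move=> b; rewrite /relation sum_slide => /ga[c cP]; exists c => j.
  have := cP i0; rewrite e0 mul0r addr0 => b0.
  have := cP j; rewrite b0 /slide_coef mulrBr => <-; ring.
Qed.

(** The family that has [`|a|] as relation. *)
Definition sign_fam alpha a : I -> L :=
  fun i => if a i < 0 then - alpha i else alpha i.

Lemma generator_abs alpha a :
  generator alpha a -> generator (sign_fam alpha a) (fun i => `|a i|).
Proof.
move=> [ra [i ai] ga]; split.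
- rewrite /relation -[RHS]ra; apply: eq_bigr => j _; rewrite /sign_fam.
  case: ifP => aj; last by rewrite ger0_norm ?leNgt ?aj.
  by rewrite ltr0_norm // mulrNz mulNrz opprK.
- by exists i; rewrite normr_eq0.
- move=> b rb.
  pose b' j := if a j < 0 then - b j else b j.
  have /ga[c cP] : relation alpha b'.
    rewrite /relation -[RHS]rb; apply: eq_bigr => j _; rewrite /sign_fam /b'.
    by case: ifP => // _; rewrite mulrNz mulNrz.
  exists c => j; have := cP j; rewrite /b'; case: ifP => aj.
    by rewrite ltr0_norm // mulrN => <-; rewrite opprK.
  by rewrite ger0_norm // leNgt aj.
Qed.

(** A multiple of [a] can have a unit entry only where [a] has one. *)
Lemma generator_unit alpha a b j : generator alpha a ->
  relation alpha b -> `|b j| = 1 -> `|a j| = 1.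
Proof.
move=> [_ _ ga] /ga[c cP]; rewrite cP normrM -!abszE -PoszM => -[/eqP].
by rewrite muln_eq1 => /andP[_ /eqP ->].
Qed.

End Relations.
Section Deltas.

Variables (I : finType) (L : zmodType) (alpha : I -> L).

Definition delta4 (i j k l : I) (p q r s : int) : I -> int :=
  fun t => (t == i)%:Z * p + (t == j)%:Z * q + (t == k)%:Z * r + (t == l)%:Z * s.

Lemma sum_delta4 i j k l p q r s :
  \sum_t alpha t *~ delta4 i j k l p q r s t =
  alpha i *~ p + alpha j *~ q + alpha k *~ r + alpha l *~ s.
Proof.
under eq_bigr do rewrite !mulrzDr !mulrzA.
by rewrite !big_split /= -!mulrz_suml !sum_delta.
Qed.

End Deltas.

(** * Roots of an even lattice *)

Record lattice_form (L : zmodType) (f : L -> L -> int) : Prop := LatticeForm {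
  form_sym : forall x y, f x y = f y x;
  form_add : forall x y z, f (x + y) z = f x z + f y z;
  form_pos : forall x, x != 0 -> 0 < f x x;
  form_even : forall x, (2 %| f x x)%Z
}.

Section Lattice.

Variables (L : zmodType) (f : L -> L -> int) (fL : lattice_form f).
Implicit Types x y z : L.

Lemma formDl x y z : f (x + y) z = f x z + f y z.
Proof. exact: form_add. Qed.

Lemma formDr x y z : f x (y + z) = f x y + f x z.
Proof. by rewrite !(form_sym fL x) formDl. Qed.

Lemma form0l y : f 0 y = 0.
Proof. by have := formDl 0 0 y; rewrite addr0; lia. Qed.

Lemma formNl x y : f (- x) y = - f x y.
Proof. by have := formDl x (- x) y; rewrite subrr form0l; lia. Qed.

Lemma formNr x y : f x (- y) = - f x y.
Proof. by rewrite !(form_sym fL x) formNl. Qed.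

Lemma formZl x y n : f (x *~ n) y = n * f x y.
Proof.
have fn k : f (x *+ k) y = k%:Z * f x y.
  elim: k => [|k IH]; first by rewrite mulr0n form0l mul0r.
  by rewrite mulrS formDl IH intS mulrDl mul1r.
case: n => n; first exact: fn.
by rewrite NegzE mulrNz formNl -pmulrn fn mulNr.
Qed.

Lemma formZr x y n : f x (y *~ n) = n * f x y.
Proof. by rewrite !(form_sym fL x) formZl. Qed.

Lemma form_suml (I : finType) (P : pred I) (F : I -> L) z :
  f (\sum_(i | P i) F i) z = \sum_(i | P i) f (F i) z.
Proof.
exact: (big_morph (fun x => f x z) (fun x y => formDl x y z) (form0l z)).
Qed.

Lemma form_sumr (I : finType) (P : pred I) (F : I -> L) z :
  f z (\sum_(i | P i) F i) = \sum_(i | P i) f z (F i).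
Proof. by rewrite form_sym // form_suml; under eq_bigr do rewrite form_sym //. Qed.

Definition formE := (formDl, formDr, formNl, formNr, formZl, formZr).

Lemma form_ge2 x : x != 0 -> 2 <= f x x.
Proof. by move=> /(form_pos fL); have := form_even fL x; lia. Qed.

Lemma cauchy_schwarz x y : f x y * f x y <= f x x * f y y.
Proof.
have [->|x0] := eqVneq x 0; first by rewrite !form0l; lia.
have fx := form_pos fL x0.
have : 0 <= f (y *~ f x x - x *~ f x y) (y *~ f x x - x *~ f x y).
  have [->|h] := eqVneq (y *~ f x x - x *~ f x y) 0; first by rewrite form0l.
  exact: ltW (form_pos fL h).
rewrite !formE (form_sym fL y x) => h.
have : 0 <= f x x * (f x x * f y y - f x y * f x y) by move: h; nia.
by rewrite pmulr_rge0 // subr_ge0.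
Qed.

Variable M : int.

(** Vectors of bounded norm whose reflection preserves the lattice.  The bound
    [M] is carried along because the replacements below create new roots, and
    reflections do not change norms. *)
Definition root x : Prop :=
  [/\ x != 0, f x x <= M & forall y, (f x x %| 2 * f x y)%Z].

Lemma root_opp x : root x -> root (- x).
Proof.
move=> [x0 xM xd]; have fxx : f (- x) (- x) = f x x by rewrite !formE opprK.
split; rewrite ?oppr_eq0 ?fxx // => y.
by rewrite formNl mulrN dvdzE abszN -dvdzE.
Qed.

Lemma root_reflect x y c : root x -> root y ->
  2 * f x y = c * f x x -> root (y - x *~ c).
Proof.
move=> [x0 _ xd] [y0 yM yd] xyc.
have fx := form_pos fL x0; have fy := form_pos fL y0.
have fz : f (y - x *~ c) (y - x *~ c) = f y y.
  rewrite !formE (form_sym fL y x).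
  transitivity (f y y - c * (2 * f x y - c * f x x)); first by ring.
  by rewrite xyc subrr mulr0 subr0.
split; rewrite ?fz //.
  by apply: contraTneq fy => z0; rewrite -fz z0 form0l ltxx.
move=> w; have /dvdzP[e xw] := xd w.
have -> : f (y - x *~ c) w = f y (w - x *~ e).
  rewrite !formE (form_sym fL y x); apply: (mulfI (lt0r_neq0 fx)).
  apply: (@mulfI _ 2) => //.
  transitivity (2 * f x x * f y w - f x x * c * (2 * f x w)); first by ring.
  rewrite xw; transitivity (2 * f x x * f y w - f x x * e * (c * f x x)).
    by ring.
  by rewrite -xyc; ring.
exact: yd.
Qed.

(** One of the two Cartan integers is -1, so that [x + y] is a reflection of [x]
    or [y]: otherwise both are at most -2, and Cauchy-Schwarz leaves only
    [y = - x]. *)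
Lemma root_add x y : root x -> root y -> f x y < 0 -> x + y != 0 ->
  root (x + y).
Proof.
move=> rx ry xy0 xy; have [x0 xM xd] := rx; have [y0 yM yd] := ry.
have fx := form_pos fL x0; have fy := form_pos fL y0.
have /dvdzP[c cE] := xd y; have /dvdzP[d dE] := yd x.
have [c1|c1] := eqVneq c (-1).
  by have := root_reflect rx ry cE; rewrite c1 mulrNz opprK addrC.
have [d1|d1] := eqVneq d (-1).
  by have := root_reflect ry rx dE; rewrite d1 mulrNz opprK.
have cs := cauchy_schwarz x y; move: dE; rewrite (form_sym fL) => dE.
have cneg : c <= -2 by nia.
have dneg : d <= -2 by nia.
have fxy : f (x + y) (x + y) <= 0.
  rewrite !formE (form_sym fL y x).
  have : f x x + f x y <= 0 by nia.
  have : f y y + f x y <= 0 by nia.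
  lia.
by have := form_pos fL xy; rewrite ltNge fxy.
Qed.

End Lattice.
(** * Circuits without a unit coefficient *)

Section Circuit.

Variables (L : zmodType) (f : L -> L -> int) (fL : lattice_form f) (M : int).
Variable I : finType.
Implicit Types (alpha : I -> L) (a e : I -> int) (i j l n : I).

Definition unitless alpha a : Prop :=
  [/\ forall i, root f M (alpha i), generator alpha a
    & forall i, `|a i| != 1].

(** Minimality for the pointwise order of the absolute values; it holds for
    instance when the sum of the [`|a i|] is smallest possible. *)
Definition minimal alpha a : Prop :=
  forall alpha' a', unitless alpha' a' ->
    (forall i, `|a' i| <= `|a i|) -> forall i, `|a' i| = `|a i|.

Section Minimal.

Variables (alpha : I -> L) (a : I -> int).
Hypotheses (ua : unitless alpha a) (mina : minimal alpha a).
Hypothesis a_ge0 : forall i, 0 <= a i.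

Let ra i : root f M (alpha i). Proof. by case: ua. Qed.
Let ga : generator alpha a. Proof. by case: ua. Qed.
Let a1 i : a i != 1.
Proof. by case: ua => _ _ /(_ i); rewrite ger0_norm. Qed.

(** The source of all the nonvanishing conditions that root_add asks for: a
    combination with a unit coefficient cannot vanish. *)
Lemma comb_neq0 b j : `|b j| = 1 -> \sum_i alpha i *~ b i != 0.
Proof.
move=> bj; apply/eqP => rb; have := generator_unit ga rb bj.
by case: ua => _ _ /(_ j) /eqP.
Qed.

Lemma comb4_neq0 i j l n q r s : j != i -> l != i -> n != i ->
  alpha i + alpha j *~ q + alpha l *~ r + alpha n *~ s != 0.
Proof.
move=> ji li ni.
have := sum_delta4 alpha i j l n 1 q r s; rewrite mulr1z => <-.
apply: (@comb_neq0 _ i).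
rewrite /delta4 eqxx !(eq_sym i) (negbTE ji) (negbTE li) (negbTE ni).
by rewrite !mul0r !addr0.
Qed.

Lemma comb2_neq0 i j q : j != i -> alpha i + alpha j *~ q != 0.
Proof.
move=> ji; have := comb4_neq0 q 0 0 ji ji ji.
by rewrite !mulr0z !addr0.
Qed.

Lemma no_smaller alpha' a' j : unitless alpha' a' ->
  (forall i, `|a' i| <= a i) -> `|a' j| < a j -> False.
Proof.
move=> u' le; rewrite -[X in _ < X](ger0_norm (a_ge0 j)) (mina u') ?ltxx // => i.
by rewrite (ger0_norm (a_ge0 i)).
Qed.

(** Only the replaced member of a family has to be checked. *)
Lemma slide_root (beta : I -> L) i0 e :
  (forall i, root f M (beta i)) -> root f M (beta i0 + \sum_j beta j *~ e j) ->
  forall i, root f M (slide beta i0 e i).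
Proof.
by move=> rb r0 i; rewrite /slide; case: eqP => [->//|_]; rewrite addr0.
Qed.

Lemma form_neq i j : f (alpha i) (alpha j) < 0 -> j != i.
Proof.
apply: contraTneq => ->; case: (ra i) => /(form_pos fL) p _ _.
by rewrite -leNgt ltW.
Qed.

(** Replacing [alpha j] by the root [alpha i + alpha j] turns [a i] into
    [a i - a j], which minimality allows only if that value is 1. *)
Lemma neg_step i j : 0 < a j -> a j <= a i -> f (alpha i) (alpha j) < 0 ->
  a i = a j + 1.
Proof.
move=> aj aji fij; have ji := form_neq fij.
apply/eqP/negPn/negP => /eqP ne.
pose e t : int := (t == i)%:Z.
have ej : e j = 0 by rewrite /e (negbTE ji).
apply: (@no_smaller (slide alpha j e) (slide_coef a j e) i).
- split.
  + apply: slide_root => //; rewrite sum_delta addrC.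
    apply: root_add => //.
    by have := comb2_neq0 1 ji; rewrite mulr1z.
  + exact: generator_slide.
  + move=> t; rewrite /slide_coef /e; case: (eqVneq t i) => [->|_] /=; last first.
      by rewrite mul0r subr0 ger0_norm.
    by apply/eqP; lia.
- move=> t; rewrite /slide_coef /e; case: (eqVneq t i) => [->|_] /=; first by lia.
  by rewrite mul0r subr0 ger0_norm.
- by rewrite /slide_coef /e eqxx; lia.
Qed.

Section Peak.

Variable o : I.
Hypotheses (a_max : forall i, a i <= a o) (ao4 : 4 <= a o).

Definition nbr : pred I := fun j => (0 < a j) && (f (alpha o) (alpha j) < 0).

Lemma nbr_neq j : nbr j -> j != o.
Proof. by case/andP => _ /form_neq. Qed.

Lemma nbr_coef j : nbr j -> a j = a o - 1.
Proof. by case/andP => aj /(neg_step aj (a_max j)) ->; rewrite addrK. Qed.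

Lemma slide_contra j e l : e j = 0 ->
  root f M (alpha j + \sum_t alpha t *~ e t) ->
  (forall t, `|a t - e t * a j| != 1) ->
  (forall t, `|a t - e t * a j| <= a t) -> `|a l - e l * a j| < a l -> False.
Proof.
move=> ej rj n1 le.
apply: (@no_smaller (slide alpha j e) (slide_coef a j e) l _ le); split => //.
  exact: slide_root.
exact: generator_slide.
Qed.

(** If the Cartan integer were at most -2, then [alpha j + 2 alpha o] would be a
    root; replacing [alpha j] by it turns [a o] into
    [a o - 2 (a o - 1) = 2 - a o]. *)
Lemma nbr_cartan j : nbr j ->
  2 * f (alpha o) (alpha j) = - f (alpha o) (alpha o).
Proof.
move=> nj; have jo := nbr_neq nj; have aj := nbr_coef nj.
case/andP: (nj) => _ fj; case: (ra o) => o0 _ /(_ (alpha j))/dvdzP[c cE].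
have fo := form_pos fL o0.
case: (eqVneq c (-1)) => [c1|c1]; first by rewrite cE c1 mulN1r.
have c2 : c <= -2 by nia.
have oj : o != j by rewrite eq_sym.
have rj : root f M (alpha j + alpha o *~ 2).
  have [c2'|c2'] := eqVneq c (-2).
    by have := root_reflect fL (ra o) (ra j) cE; rewrite c2' mulrNz opprK.
  rewrite mulrz2 addrA.
  have nz := comb2_neq0 1 oj; rewrite mulr1z in nz.
  have nz2 := comb2_neq0 2 oj; rewrite mulrz2 in nz2.
  apply: root_add; rewrite -?addrA //.
    by apply: root_add => //; rewrite form_sym.
  by rewrite formDl // (form_sym fL (alpha j)); nia.
pose e t : int := (t == o)%:Z * 2.
exfalso; apply: (@slide_contra j e o); rewrite /e ?(negbTE jo) ?eqxx //.
- by under eq_bigr do rewrite mulrzA; rewrite -mulrz_suml sum_delta.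
- move=> t; have [->|_] := eqVneq t o; first by apply/eqP; lia.
  by rewrite /= !mul0r subr0 ger0_norm.
- move=> t; have [->|_] := eqVneq t o; first by lia.
  by rewrite /= !mul0r subr0 ger0_norm.
- by lia.
Qed.

(** If the product were positive then [alpha j - alpha l] would be a root, and
    [alpha o + alpha l] is one.  Putting them in place of [alpha j] and
    [alpha o] turns [a l = a o - 1] first into [2 (a o - 1)], then into
    [a o - 2]. *)
Lemma nbr_pair j l : nbr j -> nbr l -> j != l -> f (alpha j) (alpha l) <= 0.
Proof.
move=> nj nl jl; rewrite leNgt; apply/negP => fjl.
have jo := nbr_neq nj; have lo := nbr_neq nl.
have aj := nbr_coef nj; have al := nbr_coef nl.
have lj : l != j by rewrite eq_sym.
(* The family [beta] has [alpha j - alpha l] at [j]; its relation [b] has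
   [b l = 2 (a o - 1)], too large for minimality to apply at this stage. *)
pose e1 t : int := - (t == l)%:Z; pose e2 t : int := (t == l)%:Z.
pose beta := slide alpha j e1; pose b := slide_coef a j e1.
have rb i : root f M (beta i).
  apply: slide_root => //.
  have -> : \sum_t alpha t *~ e1 t = - alpha l.
    by under eq_bigr do rewrite mulrNz; rewrite sumrN sum_delta.
  apply: root_add => //; first exact: root_opp.
    by rewrite formNr // oppr_lt0.
  by have := comb2_neq0 (-1) lj; rewrite mulrNz mulr1z.
have gb : generator beta b by apply: generator_slide; rewrite /e1 ?(negbTE jl).
have beta_o : beta o = alpha o.
  by rewrite /beta /slide eq_sym (negbTE jo) addr0.
have beta_l : beta l = alpha l.
  by rewrite /beta /slide (negbTE lj) addr0.
have bo : b o = a o.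
  by rewrite /b /slide_coef /e1 eq_sym (negbTE lo) oppr0 mul0r subr0.
pose c := slide_coef b o e2.
have cE t : c t = if t == l then a o - 2 else a t.
  rewrite /c /slide_coef bo /b /slide_coef /e1 /e2.
  by have [->|_] := eqVneq t l; lia.
apply: (@no_smaller (slide beta o e2) c l).
- split.
  + apply: slide_root => //; rewrite sum_delta beta_o beta_l.
    apply: root_add => //; first by case/andP: nl.
    by have := comb2_neq0 1 lo; rewrite mulr1z.
  + by apply: generator_slide => //; rewrite /e2 eq_sym (negbTE lo).
  + move=> t; rewrite cE; case: ifP => _; first by apply/eqP; lia.
    by rewrite ger0_norm.
- move=> t; rewrite cE; case: ifP => [/eqP->|_]; first by lia.
  by rewrite ger0_norm.
- by rewrite cE eqxx; lia.
Qed.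

(** The highest root [2 alpha o + alpha j + alpha l + alpha n] of the D4 diagram
    with centre [o] can replace [alpha j]; this turns [a o] into [2 - a o] and
    [a l], [a n] into 0. *)
Lemma nbr_triple j l n : nbr j -> nbr l -> nbr n ->
  j != l -> l != n -> n != j -> False.
Proof.
move=> nj nl nn jl ln nj'.
have jo := nbr_neq nj; have lo := nbr_neq nl; have no := nbr_neq nn.
have aj := nbr_coef nj; have al := nbr_coef nl; have an := nbr_coef nn.
have fj := nbr_cartan nj; have fl := nbr_cartan nl; have fn := nbr_cartan nn.
have fjl := nbr_pair nj nl jl; have fln := nbr_pair nl nn ln.
have fnj := nbr_pair nn nj nj'.
have fo : 0 < f (alpha o) (alpha o) by case: (ra o) => /(form_pos fL).
have oj : o != j by rewrite eq_sym.
have lj : l != j by rewrite eq_sym.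
have := comb4_neq0 1 0 0 oj lj nj'; have := comb4_neq0 1 1 0 oj lj nj'.
have := comb4_neq0 1 1 1 oj lj nj'; have := comb4_neq0 2 1 1 oj lj nj'.
rewrite !mulr1z !mulr0z !addr0 => z4 z3 z2 z1.
have [_ foj] := andP nj; have [_ fol] := andP nl; have [_ fon] := andP nn.
have r1 : root f M (alpha j + alpha o).
  by apply: root_add => //; rewrite form_sym.
have r2 : root f M (alpha j + alpha o + alpha l).
  apply: root_add => //; rewrite (formDl fL).
  by move: fjl fol; clear; lia.
have r3 : root f M (alpha j + alpha o + alpha l + alpha n).
  apply: root_add => //; rewrite !(formDl fL) (form_sym fL (alpha j)).
  by move: fnj fln fon; clear; lia.
have E : alpha j + alpha o *~ 2 + alpha l + alpha n =
         alpha j + alpha o + alpha l + alpha n + alpha o.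
  by rewrite mulrz2 addrA !(addrAC _ (alpha o)).
have r4 : root f M (alpha j + alpha o *~ 2 + alpha l + alpha n).
  rewrite E; apply: root_add => //; last by rewrite -E.
  rewrite !(formDl fL) !(form_sym fL _ (alpha o)).
  by move: fj fl fn fo; clear; lia.
pose e := delta4 o l n n 2 1 1 0.
have eE t : e t = if t == o then 2 else if (t == l) || (t == n) then 1 else 0.
  rewrite /e /delta4; have [->|_] := eqVneq t o.
    by rewrite !(eq_sym o) (negbTE lo) (negbTE no).
  by have [->|_] := eqVneq t l; [rewrite (negbTE ln)|case: eqP].
apply: (@slide_contra j e o).
- by rewrite eE (negbTE jo) (negbTE jl) eq_sym (negbTE nj').
- by rewrite sum_delta4 !mulr1z mulr0z addr0 2!addrA.
- move=> t; rewrite eE; have [->|_] := eqVneq t o; first by apply/eqP; move: aj ao4; clear; lia.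
  have [->|_] := eqVneq t l; first by apply/eqP; move: aj al an; clear => /=; lia.
  have [->|_] := eqVneq t n; first by apply/eqP; move: aj al an; clear => /=; lia.
  by rewrite /= mul0r subr0 ger0_norm.
- move=> t; rewrite eE; have [->|_] := eqVneq t o; first by move: aj ao4; clear; lia.
  have [->|_] := eqVneq t l; first by move: aj al an ao4; clear => /=; lia.
  have [->|_] := eqVneq t n; first by move: aj al an ao4; clear => /=; lia.
  by rewrite /= mul0r subr0 ger0_norm.
- by rewrite eE eqxx; move: aj ao4; clear; lia.
Qed.

(** Pair the relation with [alpha o]: the neighbours have to balance
    [a o * f (alpha o) (alpha o)], and each of them contributes
    [- (a o - 1) * f (alpha o) (alpha o) / 2]. *)
Lemma many_nbrs : (2 < #|nbr|)%N.
Proof.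
have fo : 0 < f (alpha o) (alpha o) by case: (ra o) => /(form_pos fL).
have : \sum_i a i * f (alpha o) (alpha i) = 0.
  transitivity (f (alpha o) (\sum_i alpha i *~ a i)).
    by rewrite form_sumr //; apply: eq_bigr => i _; rewrite formZr.
  by case: ga => -> _ _; rewrite form_sym // form0l.
rewrite (bigID nbr) /= => sum0.
have no : ~~ nbr o by apply/negP => /nbr_neq; rewrite eqxx.
have rest : a o * f (alpha o) (alpha o) <=
    \sum_(i | ~~ nbr i) a i * f (alpha o) (alpha i).
  rewrite (bigD1 o) //= lerDl; apply: sumr_ge0 => i /andP[].
  rewrite /nbr negb_and -!leNgt => /orP[ai|fi] _; last exact: mulr_ge0.
  by rewrite (_ : a i = 0) ?mul0r //; apply/eqP; rewrite eq_le ai a_ge0.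
have main : 2 * \sum_(i | nbr i) a i * f (alpha o) (alpha i) =
    - (#|nbr|%:Z * (a o - 1) * f (alpha o) (alpha o)).
  rewrite mulr_sumr (eq_bigr (fun=> - ((a o - 1) * f (alpha o) (alpha o)))).
    by rewrite sumr_const -mulr_natl natz mulrN mulrA.
  by move=> i ni; rewrite (nbr_coef ni) mulrCA nbr_cartan // mulrN.
have : 2 * (a o * f (alpha o) (alpha o)) <=
       #|nbr|%:Z * (a o - 1) * f (alpha o) (alpha o).
  by rewrite -[leRHS]opprK -main -mulrN ler_pM2l // (addr0_eq sum0).
rewrite mulrA ler_pM2r //; move: ao4; clear; nia.
Qed.

Lemma peak_absurd : False.
Proof.
have /card_gt2P[j [l [n [[nj nl nn] [jl ln nj']]]]] := many_nbrs.
exact: nbr_triple nj nl nn jl ln nj'.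
Qed.

End Peak.

Section Low.

Hypothesis a_le3 : forall i, a i <= 3.

Let supp : pred I := fun i => a i != 0.
Let z := \sum_(i | supp i) alpha i.

Lemma low_supp i : supp i -> a i = 2 \/ a i = 3.
Proof.
rewrite /supp => /eqP ai; have := a_le3 i; have := a_ge0 i; have /eqP := a1 i.
lia.
Qed.

Lemma supp_sum (c : I -> int) :
  \sum_(i | supp i) alpha i *~ c i =
  \sum_i alpha i *~ (if supp i then c i else 0).
Proof.
by rewrite big_mkcond; apply: eq_bigr => i _; case: ifP => // _; rewrite mulr0z.
Qed.

(** A combination with coefficient 1 away from [i] can vanish only if there is
    nothing away from [i]; then [c *: alpha i = 0]. *)
Lemma low_comb_neq0 i (c : int) : supp i ->
  \sum_(j | supp j) alpha j *~ (if j == i then c else 1) = 0 -> c = 0.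
Proof.
move=> si zc.
have only j : supp j -> j = i.
  move=> sj; apply/eqP/negPn/negP => ji.
  move: zc; rewrite supp_sum => /eqP; apply/negP.
  by apply: (@comb_neq0 _ j); rewrite sj (negbTE ji).
move: zc; rewrite (bigD1 i) //= eqxx big1 ?addr0 => [|j /andP[/only ->]]; last first.
  by rewrite eqxx.
move=> /(congr1 (f (alpha i))); rewrite formZr // (form_sym fL _ 0) form0l // => /eqP.
rewrite mulf_eq0 => /orP[/eqP //|/eqP fi].
by case: (ra i) => /(form_pos fL); rewrite fi ltxx.
Qed.

Lemma low_sum_neq0 : z != 0.
Proof.
case: ga => _ [i ai] _; apply/eqP => z0.
have : (1 : int) = 0; last by [].
apply: (low_comb_neq0 (i := i)) => //; rewrite -[RHS]z0; apply: eq_bigr => j _.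
by rewrite if_same mulr1z.
Qed.

Let g i := if a i == 2 then alpha i else - alpha i.

(** The difference of the two sides is [-2] times the relation, since
    [1 - 5 = -2 * 2] and [-1 - 5 = -2 * 3]. *)
Lemma low_sum5 : \sum_(i | supp i) g i = z *~ 5.
Proof.
apply/eqP; rewrite -subr_eq0; apply/eqP.
rewrite /z mulrz_suml -sumrB.
transitivity ((\sum_i alpha i *~ a i) *~ (-2)); last first.
  by case: ga => -> _ _; rewrite mul0rz.
rewrite mulrz_suml [RHS](bigID supp) /= [X in _ + X]big1 ?addr0; last first.
  by move=> i /negPn/eqP ->; rewrite mulr0z mul0rz.
apply: eq_bigr => i /low_supp[] ai; rewrite /g ai /= -mulrzA.
  by rewrite -[X in X - _]mulr1z -mulrzBr.
by rewrite -[X in X - _]mulrN1z -mulrzBr.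
Qed.

(** The norm of the nonzero vector [z - g i] is at least 2. *)
Lemma low_norm i : supp i -> 2 * f (g i) z <= f z z + f (alpha i) (alpha i) - 2.
Proof.
move=> si.
have zg : z - g i != 0.
  pose c : int := if a i == 2 then 0 else 2.
  have zgE : z - g i = \sum_(j | supp j) alpha j *~ (if j == i then c else 1).
    rewrite (bigD1 i) //= eqxx /z (bigD1 i) //= addrAC; congr (_ + _).
      rewrite /g /c; case: ifP => _; first by rewrite subrr mulr0z.
      by rewrite opprK mulrz2.
    by apply: eq_bigr => j /andP[_ /negbTE ->]; rewrite mulr1z.
  case: (low_supp si) => ai; last first.
    by apply/eqP; rewrite zgE => /(low_comb_neq0 si); rewrite /c ai.
  case: (pickP [pred j | supp j & j != i]) => [j /andP[sj ji]|none].
    rewrite zgE supp_sum; apply: (@comb_neq0 _ j).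
    by rewrite sj (negbTE ji).
  case: ga => rel _ _; have := rel; rewrite /relation (bigD1 i) //= big1; last first.
    move=> j ji; have := none j; rewrite /= ji andbT => /negbFE/eqP ->.
    by rewrite mulr0z.
  rewrite addr0 ai => /(congr1 (f (alpha i))).
  rewrite formZr // (form_sym fL _ 0) form0l //.
  by case: (ra i) => /(form_pos fL); lia.
have := form_ge2 fL zg; rewrite !(formE fL) (form_sym fL z).
have -> : f (g i) (g i) = f (alpha i) (alpha i).
  by rewrite /g; case: ifP => // _; rewrite !(formE fL) opprK.
lia.
Qed.

Lemma low_bound :
  10 * f z z <= \sum_(i | supp i) (f z z + f (alpha i) (alpha i) - 2).
Proof.
have -> : 10 * f z z = \sum_(i | supp i) 2 * f (g i) z.
  by rewrite -mulr_sumr -form_suml // low_sum5 formZl // mulrA.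
exact: ler_sum low_norm.
Qed.

(** A root of norm 4 has even products with the whole lattice, and norms are
    additive modulo twice a product. *)
Lemma norm_dvd4 : (forall i, supp i -> f (alpha i) (alpha i) = 4) ->
  (4 %| f z z)%Z.
Proof.
move=> n4.
pose Q x := (4 %| f x x)%Z /\ forall y, (2 %| f x y)%Z.
suff: Q z by case.
apply: big_ind => [|x y [x4 x2] [y4 y2]|i /n4 fi]; split.
- by rewrite form0l.
- by move=> y; rewrite form0l.
- by rewrite !(formE fL) (form_sym fL y x); have := x2 y; lia.
- by move=> w; rewrite formDl //; have := x2 w; have := y2 w; lia.
- by rewrite fi.
- by move=> y; case: (ra i) => _ _ /(_ y); rewrite fi; lia.
Qed.

Lemma low_absurd :
  [\/ M <= 2 /\ (#|I| <= 9)%N, M <= 4 /\ (#|I| <= 5)%N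
     | M <= 6 /\ (#|I| <= 3)%N] -> False.
Proof.
have zN := form_ge2 fL low_sum_neq0; have lb := low_bound.
have cI : (#|supp| <= #|I|)%N by exact: max_card.
have ub : \sum_(i | supp i) (f z z + f (alpha i) (alpha i) - 2) <=
          #|supp|%:Z * (f z z + M - 2).
  rewrite -natz mulr_natl -sumr_const; apply: ler_sum => i _.
  by case: (ra i); lia.
move=> H; have : 10 * f z z <= #|supp|%:Z * (f z z + M - 2) := le_trans lb ub.
(* In the middle case the bound reads [10 N <= 5 (N + 2)], with [N >= 2]. *)
have [[M2 c]|[M4 c]|[M6 c]] := H; [nia| |nia] => b.
have fz : f z z = 2 by nia.
have cs : #|supp| = 5%N by move: b; rewrite fz; nia.
have n4 i : supp i -> f (alpha i) (alpha i) = 4.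
  move=> si; have fi : f (alpha i) (alpha i) <= 4 by case: (ra i); lia.
  apply/eqP; rewrite eq_le fi /= leNgt; apply/negP => lt4.
  have : \sum_(j | supp j) (f z z + f (alpha j) (alpha j) - 2) <
         \sum_(j | supp j) (4 : int).
    rewrite (bigD1 i) //= [X in _ < X](bigD1 i) //=.
    apply: ltr_leD; first by rewrite fz; lia.
    by apply: ler_sum => j _; case: (ra j); rewrite fz; lia.
  rewrite sumr_const cs; move: lb; rewrite fz; lia.
by have := norm_dvd4 n4; rewrite fz.
Qed.

End Low.

End Minimal.

(** The three cases are met by types E, F4 and G2, in this order. *)
Theorem circuit_unit alpha a :
  [\/ M <= 2 /\ (#|I| <= 9)%N, M <= 4 /\ (#|I| <= 5)%N
     | M <= 6 /\ (#|I| <= 3)%N] ->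
  (forall i, root f M (alpha i)) -> generator alpha a -> exists i, `|a i| = 1.
Proof.
move=> small; have [k] := ubnP (\sum_i `|a i|)%N.
elim: k alpha a => // k IH alpha a ak ra ga.
have [//|no1] := pselect (exists i, `|a i| = 1); exfalso.
pose alpha' := sign_fam alpha a; pose a' i := `|a i|.
have ua : unitless alpha' a'.
  split; last 1 first.
  - by move=> i; rewrite normr_id; apply/eqP => ai; apply: no1; exists i.
  - by move=> i; rewrite /alpha' /sign_fam; case: ifP => // _; apply: root_opp.
  - exact: generator_abs.
have a'_ge0 i : 0 <= a' i by exact: normr_ge0.
have mina : minimal alpha' a'.
  move=> beta b [rb gb b1] le j; apply/eqP/negPn/negP => bj.
  have [|i bi] := IH beta b _ rb gb; last by have := b1 i; rewrite bi eqxx.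
  rewrite ltnS in ak; apply: leq_trans ak; rewrite (bigD1 j) //=.
  rewrite [X in (_ < X)%N](bigD1 j) //= -addSn leq_add //.
    by have := le j; move: bj; rewrite /a' normr_id; lia.
  by apply: leq_sum => i _; have := le i; rewrite /a' normr_id; lia.
have [i0 _] : exists i, a i != 0 by case: ga.
case: (@arg_maxP _ _ I i0 xpredT a' isT) => o _ omax.
have [ao|ao] := leP (a' o) 3.
  apply: (low_absurd ua a'_ge0 _ small) => i; exact: le_trans (omax i isT) ao.
by apply: (peak_absurd ua mina a'_ge0 (o := o)) => [i|]; [exact: omax|lia].
Qed.

End Circuit.
(** * From dependent families to circuits *)

Section Families.

Variable L : zmodType.

Definition dependent (I : finType) (alpha : I -> L) : Prop :=
  exists b, relation alpha b /\ exists i, b i != 0.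

Definition unit_relation (I : finType) (alpha : I -> L) : Prop :=
  exists b, relation alpha b /\ exists j, `|b j| = 1.

(** Extension by zero from a subtype. *)
Definition zext (I : finType) (P : pred I) (b : {i | P i} -> int) : I -> int :=
  fun i => if insub i is Some j then b j else 0.

Lemma sum_zext (I : finType) (P : pred I) (alpha : I -> L) b :
  \sum_i alpha i *~ zext b i = \sum_(j : {i | P i}) alpha (val j) *~ b j.
Proof.
rewrite (bigID P) /= [X in _ + X]big1 ?addr0 => [|i nPi]; last first.
  by rewrite /zext insubF ?mulr0z //; apply/negbTE.
rewrite (reindex_omap (val : {i | P i} -> I) insub) => [|i Pi]; last first.
  by rewrite insubT.
apply: eq_big => j; first by rewrite valK (valP j) eqxx.
by move=> _; rewrite /zext valK.
Qed.

Lemma relationB (I : finType) (alpha : I -> L) (b a : I -> int) q :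
  relation alpha b -> relation alpha a ->
  relation alpha (fun i => b i - a i * q).
Proof.
move=> rb ra; rewrite /relation; under eq_bigr do rewrite mulrzBr mulrzA.
by rewrite sumrB -mulrz_suml rb ra mul0rz subr0.
Qed.

(** Take relations of minimal support [b0], and among those with support inside
    it one that is smallest at a fixed index [i0]: division with remainder at
    [i0] shows that it generates. *)
Lemma exists_circuit (I : finType) (alpha : I -> L) : dependent alpha ->
  exists a, [/\ relation alpha a, exists i, a i != 0
    & forall b, relation alpha b -> (forall i, a i = 0 -> b i = 0) ->
      exists c, forall i, b i = c * a i].
Proof.
move=> dep.
have ex1 : exists k, `[< exists b, [/\ relation alpha b, exists i, b i != 0
    & #|[pred i | b i != 0]| = k] >].
  by case: dep => b [rb b0]; exists #|[pred i | b i != 0]|; apply/asboolP; exists b.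
case: (ex_minnP ex1) => k /asboolP[b0 [rb0 [i0 bi0] kE]] kmin.
have ex2 : exists n, `[< exists b, [/\ relation alpha b, b i0 != 0,
    forall i, b0 i = 0 -> b i = 0 & absz (b i0) = n] >].
  by exists (absz (b0 i0)); apply/asboolP; exists b0.
case: (ex_minnP ex2) => n /asboolP[a [ra ai0 ab0 nE]] nmin.
exists a; split=> //; first by exists i0.
move=> b rb ba; exists (b i0 %/ a i0)%Z => i.
pose q := (b i0 %/ a i0)%Z.
have rd := relationB q rb ra.
have db0 t : b0 t = 0 -> b t - a t * q = 0.
  by move=> /ab0 at0; rewrite at0 ba // mul0r subrr.
have di0 : b i0 - a i0 * q = 0.
  apply/eqP/negPn/negP => di0.
  have /nmin : `[< exists b', [/\ relation alpha b', b' i0 != 0,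
      forall i, b0 i = 0 -> b' i = 0 & absz (b' i0) = absz (b i0 - a i0 * q)%R] >].
    by apply/asboolP; exists (fun t => b t - a t * q).
  rewrite /q; have := ltz_mod (b i0) ai0; have := modz_ge0 (b i0) ai0.
  by rewrite /modz -nE; lia.
apply/eqP; rewrite mulrC -subr_eq0; apply/negPn/negP => di.
have /kmin : `[< exists b', [/\ relation alpha b', exists i, b' i != 0
    & #|[pred i | b' i != 0]| = #|[pred i | b i - a i * q != 0]|] >].
  by apply/asboolP; exists (fun t => b t - a t * q); split=> //; exists i.
rewrite -kE leqNgt; apply/negP/negPn/proper_card/properP; split.
  by apply/subsetP => t; rewrite !inE; apply: contraNN => /eqP/db0 ->.
by exists i0; rewrite !inE ?di0 ?eqxx.
Qed.

Variables (r : nat) (f : L -> L -> int) (M : int).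
Hypotheses (fL : lattice_form f)
  (rankL : forall (J : finType) (beta : J -> L), (r < #|J|)%N -> dependent beta).

(** A circuit in a lattice of rank [r] has at most [r + 1] members, since
    dropping a member leaves an independent family. *)
Theorem root_unit_relation (I : finType) (alpha : I -> L) :
  [\/ M <= 2 /\ (r <= 8)%N, M <= 4 /\ (r <= 4)%N | M <= 6 /\ (r <= 2)%N] ->
  (forall i, root f M (alpha i)) -> dependent alpha -> unit_relation alpha.
Proof.
move=> small ralpha /exists_circuit[a [ra [i0 ai0] ga]].
pose P i := a i != 0; pose J := {i | P i}.
pose alpha' (j : J) := alpha (val j); pose a' (j : J) := a (val j).
have extz (b : J -> int) i : a i = 0 -> zext b i = 0.
  by move=> ai; rewrite /zext insubF // /P ai eqxx.
have exta : zext a' = a.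
  apply/funext => i; have [ai|ai] := eqVneq (a i) 0; first by rewrite ai extz.
  by rewrite /zext insubT.
have ga' : generator alpha' a'.
  split.
  - by rewrite /relation -sum_zext exta.
  - by exists (Sub i0 ai0); rewrite /a' SubK.
  - move=> b rb; have [||c cE] := ga (zext b).
    + by rewrite /relation sum_zext.
    + exact: extz.
    exists c => j; rewrite /a' -cE; by rewrite /zext valK.
have cJ : (#|{: J}| <= r.+1)%N.
  rewrite leqNgt; apply/negP => big.
  pose j0 : J := Sub i0 ai0.
  have [|b [rb [j bj]]] := @rankL {j : J | j != j0} (fun j => alpha' (val j)).
    by rewrite card_sub (cardC1 j0) ltn_predRL.
  case: ga' => _ _ /(_ (zext b)) [|c cE]; first by rewrite /relation sum_zext.
  have := cE j0; rewrite {1}/zext insubF ?eqxx // => /esym/eqP.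
  rewrite mulf_eq0 (negbTE (valP j0 : a' j0 != 0)) orbF => /eqP c0.
  have := cE (val j); rewrite /zext valK c0 mul0r => bj0.
  by rewrite bj0 eqxx in bj.
have [|j|j aj] := circuit_unit fL (M := M) _ _ ga'.
- by case: small => [[m h]|[m h]|[m h]]; [apply: Or31|apply: Or32|apply: Or33];
    (split; [exact: m|exact: leq_trans cJ _]).
- exact: ralpha.
by exists a; split => //; exists (val j).
Qed.

End Families.

Section IntegerRows.

Variables (r k : nat) (alpha : 'I_k -> 'rV[int]_r).

(** Clear the denominators. *)
Lemma rat_relation (u : 'I_k -> rat) : (exists i, u i != 0) ->
  (forall c, \sum_i u i * (alpha i 0 c)%:~R = 0) -> dependent alpha.
Proof.
move=> [i ui] u0.
pose D := \prod_j denq (u j).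
have Dn j : D = denq (u j) * \prod_(t | t != j) denq (u t).
  by rewrite /D (bigD1 j).
pose b j := numq (u j) * \prod_(t | t != j) denq (u t).
have bE j : (b j)%:~R = D%:~R * u j :> rat.
  by rewrite (Dn j) /b !intrM numqE; ring.
exists b; split; last first.
  exists i; rewrite -(intr_eq0 rat) bE mulf_neq0 // intr_eq0.
  by apply/prodf_neq0 => j _; exact: denq_neq0.
apply/rowP => c; rewrite summxE mxE; apply: (@intr_inj rat).
rewrite rmorph_sum /= mulr0z.
transitivity (D%:~R * \sum_i u i * (alpha i 0 c)%:~R); last by rewrite u0 mulr0.
rewrite mulr_sumr; apply: eq_bigr => j _.
have -> : (alpha j *~ b j) 0 c = alpha j 0 c * b j.
  by rewrite -scaler_int mxE intz mulrC.
by rewrite intrM bE; ring.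
Qed.

Definition ratmx : 'M[rat]_(k, r) := \matrix_(i, c) (alpha i 0 c)%:~R.

Lemma ratmx_dependent : ~~ row_free ratmx -> dependent alpha.
Proof.
rewrite -kermx_eq0 => /rowV0Pn[u /sub_kermxP uX u0].
apply: (@rat_relation (fun i => u 0 i)).
  apply/existsP; apply: contraNT u0; rewrite negb_exists => /forallP u0.
  by apply/eqP/rowP => i; rewrite mxE; apply/eqP/negPn/u0.
move=> c; move/rowP: uX => /(_ c); rewrite !mxE => uX; rewrite -[RHS]uX.
by apply: eq_bigr => i _; rewrite mxE.
Qed.

End IntegerRows.

Lemma rank_dependent r (J : finType) (beta : J -> 'rV[int]_r) :
  (r < #|J|)%N -> dependent beta.
Proof.
move=> big; have [|b [rb [i bi]]] := @ratmx_dependent r #|J| (beta \o enum_val).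
  by rewrite /row_free neq_ltn (leq_ltn_trans (rank_leq_col _) big).
exists (b \o enum_rank); split; last by exists (enum_val i); rewrite /= enum_valK.
rewrite /relation (reindex_onto enum_val enum_rank) /= => [|j _]; last first.
  exact: enum_rankK.
rewrite -[RHS]rb; apply: eq_big => j; first by rewrite enum_valK eqxx.
by move=> _; rewrite enum_valK.
Qed.
(** * Integer vectors of l1 norm at most 2 *)

Section ShortVectors.

Variable N : nat.
Implicit Types x y : 'rV[int]_N.

Definition l1norm x : int := \sum_c `|x 0 c|.

Lemma l1norm_split x c : l1norm x = `|x 0 c| + \sum_(d | d != c) `|x 0 d|.
Proof. by rewrite /l1norm (bigD1 c). Qed.

(** If [x 0 c] is a unit, the rest of [x] has l1 norm at most 1, and adding
    [q] times it costs at most the [`|y 0 c|] that is removed.  If [x 0 c] is 2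
    or -2, the rest of [x] is 0. *)
Lemma l1norm_contract x y c q : l1norm x <= 2 -> l1norm y <= 2 ->
  x 0 c != 0 -> y 0 c = q * x 0 c -> l1norm (y - x *~ q) <= 2.
Proof.
rewrite !(l1norm_split _ c) => x2 y2 xc yc.
have E d : (y - x *~ q) 0 d = y 0 d - q * x 0 d.
  by rewrite -scaler_int !mxE intz.
rewrite E yc subrr normr0 add0r.
have tail : \sum_(d | d != c) `|(y - x *~ q) 0 d| <=
    \sum_(d | d != c) `|y 0 d| + `|q| * \sum_(d | d != c) `|x 0 d|.
  rewrite mulr_sumr -big_split /=; apply: ler_sum => d _.
  by rewrite E -normrM; exact: ler_normB.
apply: le_trans tail _.
have X0 : 0 <= \sum_(d | d != c) `|x 0 d| by apply: sumr_ge0.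
have Y0 : 0 <= \sum_(d | d != c) `|y 0 d| by apply: sumr_ge0.
have xc1 : 1 <= `|x 0 c| by move: xc; clear; lia.
move: x2 y2 X0 Y0 xc1; rewrite yc normrM.
move: (\sum_(d | _) _) (\sum_(d | _) _) `|x 0 c| `|q| (normr_ge0 q) => X Y m p.
by clear; nia.
Qed.

Lemma l1norm_coord x c : l1norm x <= 2 -> `|x 0 c| <= 2.
Proof.
rewrite (l1norm_split _ c); apply: le_trans.
by rewrite lerDl; apply: sumr_ge0.
Qed.

Lemma contract_sum (I : finType) (alpha : I -> 'rV[int]_N) i1 (q b : I -> int) :
  \sum_j (alpha j - alpha i1 *~ q j) *~ b j =
  \sum_j alpha j *~ b j - alpha i1 *~ \sum_j q j * b j.
Proof.
under eq_bigr do rewrite mulrzBl -mulrzA.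
by rewrite sumrB mulrz_sumr.
Qed.

(** Contraction, by induction on the size of the index set [T]. *)
Lemma l1_unit_relation_on (I : finType) (T : {set I}) (alpha : I -> 'rV[int]_N) :
  (forall i, i \in T -> l1norm (alpha i) <= 2) ->
  (exists b, [/\ relation alpha b, forall i, i \notin T -> b i = 0
    & exists i, b i != 0]) ->
  exists b, [/\ relation alpha b, forall i, i \notin T -> b i = 0
    & exists j, `|b j| = 1].
Proof.
have [n] := ubnP #|T|.
elim: n T alpha => // n IH T alpha Tn short [b [rb bT [i0 bi0]]].
have i0T : i0 \in T by apply: contraNT bi0 => /bT ->.
have [a0|a0] := eqVneq (alpha i0) 0.
  exists (fun t => (t == i0)%:Z); split.
  - by rewrite /relation sum_delta.
  - by move=> i; case: eqVneq => // ->; rewrite i0T.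
  - by exists i0; rewrite eqxx.
have [c ac] : exists c, alpha i0 0 c != 0.
  apply/existsP; apply: contraNT a0; rewrite negb_exists => /forallP a0.
  by apply/eqP/rowP => c; rewrite mxE; apply/eqP/negPn/a0.
pose P i := (i \in T) && (alpha i 0 c != 0).
have P0 : P i0 by rewrite /P i0T.
(* Absolute values are at most 2, and 2 is chosen only if 1 does not occur: so
   the chosen entry divides the others. *)
case: (@arg_minnP I i0 P (fun i => absz (alpha i 0 c)) P0) => i1 /andP[i1T a1] amin.
pose q j := (alpha j 0%R c %/ alpha i1 0%R c)%Z.
have qE j : j \in T -> alpha j 0 c = q j * alpha i1 0 c.
  move=> jT; rewrite /q divzK //.
  have := l1norm_coord c (short _ i1T); have := l1norm_coord c (short _ jT).
  have := amin j; rewrite /P jT /=; move: a1; clear.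
  move: (alpha j 0 c) (alpha i1 0 c) => u v v0 h u2 v2.
  have [->|u0] := eqVneq u 0; first exact: dvdz0.
  have {}h := h u0; rewrite dvdzE.
  have [v1|v1] : `|v|%N = 1%N \/ `|v|%N = `|u|%N by lia.
    by rewrite v1 dvd1n.
  by rewrite v1.
have q1 : q i1 = 1 by rewrite /q divzz a1.
pose alpha' j := alpha j - alpha i1 *~ q j.
(* The contracted family keeps the relation [b]: its defect is a multiple of
   [alpha i1], and vanishes at [c]. *)
have alpha'1 : alpha' i1 = 0 by rewrite /alpha' q1 mulr1z subrr.
have alpha'c j : j \in T -> alpha' j 0 c = 0.
  by move=> /qE E; rewrite /alpha' -scaler_int !mxE intz E subrr.
have rb' : relation alpha' b.
  rewrite /relation /alpha' contract_sum rb sub0r.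
  suff -> : \sum_j q j * b j = 0 by rewrite mulr0z oppr0.
  have : (\sum_j alpha' j *~ b j) 0 c = 0.
    rewrite summxE big1 // => j _; rewrite -scaler_int mxE.
    have [/alpha'c ->|/bT ->] := boolP (j \in T); first by rewrite mulr0.
    by rewrite mul0r.
  rewrite /alpha' contract_sum rb sub0r -scaler_int !mxE intz => /eqP.
  by rewrite oppr_eq0 mulf_eq0 (negbTE a1) orbF => /eqP.
have [|||b2 [rb2 b2T [j bj]]] := IH (T :\ i1) alpha'.
- by have := cardsD1 i1 T; rewrite i1T; move: Tn; clear; lia.
- move=> i /setD1P[_ iT]; apply: (l1norm_contract (c := c)); rewrite ?short //.
  exact: qE.
- exists (fun j => if j == i1 then 0 else b j); split.
  + rewrite /relation -[RHS]rb'; apply: eq_bigr => j _.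
    by case: eqP => // ->; rewrite alpha'1 !mul0rz.
  + move=> i; rewrite !inE negb_and negbK; case: eqP => //= _; exact: bT.
  + apply/existsP; apply: contraNT bi0; rewrite negb_exists => /forallP b0.
    have {}b0 i : i != i1 -> b i = 0.
      by move=> ii1; have := b0 i; rewrite (negbTE ii1) => /negPn/eqP.
    have [->|/b0 -> //] := eqVneq i0 i1.
    have := congr1 (fun x : 'rV_N => x 0 c) rb; rewrite (bigD1 i1) //= big1.
      by rewrite addr0 -scaler_int !mxE intz => /eqP;
        rewrite mulf_eq0 (negbTE a1) orbF.
    by move=> i /b0 ->; rewrite mulr0z.
pose s := \sum_t q t * b2 t.
exists (fun t => b2 t - (t == i1)%:Z * s); split.
- have := relationB s rb2; move: rb2; rewrite /relation /alpha' contract_sum => r2 _.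
  by under eq_bigr do rewrite mulrzBr mulrzA; rewrite sumrB -mulrz_suml sum_delta.
- move=> i iT; rewrite b2T ?inE ?(negbTE iT) ?andbF //.
  by case: eqP iT => [->|_ _]; rewrite ?i1T // mul0r subr0.
- exists j; case: eqP bj => [->|_ bj]; last by rewrite mul0r subr0.
  by rewrite b2T // !inE eqxx.
Qed.

Theorem l1_unit_relation (I : finType) (alpha : I -> 'rV[int]_N) :
  (forall i, l1norm (alpha i) <= 2) -> dependent alpha -> unit_relation alpha.
Proof.
move=> short [b [rb b0]].
have [||b' [rb' _ u]] := @l1_unit_relation_on I setT alpha.
- by move=> i _; exact: short.
- by exists b; split => // i; rewrite inE.
- by exists b'.
Qed.

End ShortVectors.
(** * Coordinates in a basis of simple roots *)

Section BasedRootSystem.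

Variables (R : realType) (V : vectType R) (ip : {dot V for idfun}).
Implicit Types u v w : V.

Lemma ip_sym u v : ip u v = ip v u.
Proof. by rewrite hermC expr0 mul1r. Qed.

Lemma ip_suml (I : finType) (F : I -> V) v :
  ip (\sum_i F i) v = \sum_i ip (F i) v.
Proof.
apply: (big_morph (fun u => ip u v)); last exact: linear0l.
by move=> x y; rewrite linearDl.
Qed.

Lemma ip_Mzl u v (n : int) : ip (u *~ n) v = n%:~R * ip u v.
Proof. by rewrite -scaler_int linearZl_LR. Qed.

Lemma reflection_ip a u v : ip a a != 0 ->
  ip (reflection ip a u) (reflection ip a v) = ip u v.
Proof.
move=> a0; rewrite /reflection !(linearBl, linearBr) /=.
rewrite !(linearZl_LR, linearZr) /= /cartan_number (ip_sym a v).
by field.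
Qed.

Lemma reflectionK a v : ip a a != 0 -> reflection ip a (reflection ip a v) = v.
Proof.
move=> a0; rewrite /reflection -addrA -opprD -scalerDl /cartan_number.
rewrite linearBl /= linearZl_LR /= /cartan_number.
have -> : 2 * ip v a / ip a a + 2 * (ip v a - 2 * ip v a / ip a a * ip a a) / ip a a
  = 0 by field.
by rewrite scale0r subr0.
Qed.

Variables (Phi : seq V) (r : nat) (B : 'I_r -> V).
Hypotheses (Phi_root : root_system ip Phi) (Phi_red : reduced Phi).

(** A simple system indexed by a function, so that its members can be renumbered
    freely. *)
Record simple_basis : Prop := SimpleBasis {
  sb_root : forall i, B i \in Phi;
  sb_free : forall c : 'I_r -> R, \sum_i c i *: B i = 0 -> forall i, c i = 0;
  sb_sign : forall v, v \in Phi ->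
    (exists c : 'I_r -> nat, v = \sum_i B i *+ c i) \/
    (exists c : 'I_r -> nat, - v = \sum_i B i *+ c i)
}.

Hypothesis B_simple : simple_basis.

Definition emb (x : 'rV[int]_r) : V := \sum_i B i *~ x 0 i.

Lemma emb_is_additive : zmod_morphism emb.
Proof.
move=> x y; rewrite /emb -sumrB; apply: eq_bigr => i _.
by rewrite !mxE mulrzBr.
Qed.

HB.instance Definition _ :=
  GRing.isZmodMorphism.Build 'rV[int]_r V emb emb_is_additive.

Lemma emb_eq0 x : emb x = 0 -> x = 0.
Proof.
rewrite /emb => x0; apply/rowP => i; rewrite mxE; apply/eqP.
rewrite -(intr_eq0 R); apply/eqP; move: i; apply: (sb_free B_simple).
by rewrite -[RHS]x0; apply: eq_bigr => i _; rewrite scaler_int.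
Qed.

Lemma emb_inj : injective emb.
Proof.
by move=> x y /eqP; rewrite -subr_eq0 -raddfB => /eqP/emb_eq0/eqP; rewrite subr_eq0 => /eqP.
Qed.

Lemma emb_nat (c : 'I_r -> nat) : \sum_i B i *+ c i = emb (\row_i (c i)%:Z).
Proof. by apply: eq_bigr => i _; rewrite mxE pmulrn. Qed.

Lemma emb_delta i : emb (delta_mx 0 i) = B i.
Proof.
rewrite /emb (bigD1 i) //= mxE !eqxx mulr1z big1 ?addr0 // => j /negbTE ji.
by rewrite mxE ji mulr0z.
Qed.

Lemma relation_emb (I : finType) (x : I -> 'rV[int]_r) b :
  \sum_i emb (x i) *~ b i = emb (\sum_i x i *~ b i).
Proof. by rewrite raddf_sum; apply: eq_bigr => i _; rewrite raddfMz. Qed.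

Lemma root_norm_gt0 v : v \in Phi -> 0 < ip v v.
Proof.
move=> vP; apply: neq0_dnorm_gt0; apply: contraNneq (root_neq0 Phi_root).
by move=> <-.
Qed.

Lemma cartan_int u v : u \in Phi -> v \in Phi ->
  exists m : int, cartan_number ip u v = m%:~R.
Proof. by move=> uP vP; have /intrP := root_integral Phi_root vP uP. Qed.

(** A positive root [v] has positive product with some simple root [B i] that
    occurs in it.  The reflection of [v] in [B i] is a smaller positive root,
    unless [v] is a multiple of [B i], and then [v = B i] as the system is
    reduced. *)
Lemma positive_root_ind (Q : V -> Prop) :
  (forall i, Q (B i)) ->
  (forall i v, v \in Phi -> Q v -> Q (reflection ip (B i) v)) ->
  forall c : 'I_r -> nat, \sum_i B i *+ c i \in Phi -> Q (\sum_i B i *+ c i).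
Proof.
move=> QB Qr c; have [n] := ubnP (\sum_i c i)%N.
elim: n c => // n IH c cn; set v := \sum_i _ => vP.
have v0 := root_norm_gt0 vP.
have [i civ] : exists i, 0 < ip (B i *+ c i) v.
  apply/existsP; apply: contraTT v0; rewrite negb_exists => /forallP le.
  rewrite -leNgt {1}/v ip_suml sumr_le0 // => i _.
  by rewrite leNgt le.
have {civ} [ci biv] : (0 < c i)%N /\ 0 < ip v (B i).
  move: civ; rewrite pmulrn ip_Mzl ip_sym => civ.
  case: (posnP (c i)) => [ci|ci]; first by rewrite ci mul0r ltxx in civ.
  by split=> //; rewrite pmulr_rgt0 ?ltr0z // in civ.
have BP := sb_root B_simple i; have B0 := root_norm_gt0 BP.
have [m mE] := cartan_int vP BP.
have m0 : 0 < m by rewrite -(ltr0z R) -mE divr_gt0 // mulr_gt0.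
have refE : reflection ip (B i) v = emb (\row_j (c j)%:Z - delta_mx 0 i *~ m).
  by rewrite raddfB raddfMz /= emb_delta -emb_nat /reflection mE scaler_int.
have refP := root_reflection Phi_root BP vP.
have coord j : (\row_j (c j)%:Z - delta_mx 0 i *~ m) 0 j =
    (c j)%:Z - (j == i)%:Z * m.
  by rewrite -scaler_int !mxE eqxx /= intz mulrC; case: (j == i).
case: (sb_sign B_simple refP) => -[d].
- rewrite refE emb_nat => /emb_inj/rowP dE.
  have dj j : (c j)%:Z - (j == i)%:Z * m = d j.
    by have := dE j; rewrite coord mxE.
  rewrite -[v](reflectionK v (lt0r_neq0 B0)).
  apply: Qr => //; rewrite refE.
  have rowE : \row_j (c j)%:Z - delta_mx 0 i *~ m = \row_j (d j)%:Z.
    exact/rowP.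
  rewrite rowE -emb_nat; apply: IH; last by rewrite emb_nat -rowE -refE.
  rewrite ltnS in cn; apply: leq_trans cn; rewrite (bigD1 i) //= [X in (_ < X)%N](bigD1 i) //=.
  rewrite -addSn leq_add //.
    by have := dj i; rewrite eqxx; move: m0; clear; lia.
  apply: leq_sum => j /negbTE ji; have := dj j; rewrite ji /= mul0r subr0.
  by clear; lia.
- rewrite refE emb_nat -raddfN => /emb_inj/rowP dE.
  have cj j : j != i -> c j = 0%N.
    move=> ji; have := dE j; rewrite [LHS]mxE coord mxE (negbTE ji).
    by clear; lia.
  have vE : v = (c i)%:R *: B i.
    rewrite /v (bigD1 i) //= big1 ?addr0 ?scaler_nat // => j /cj ->.
    by rewrite mulr0n.
  have : (c i)%:R *: B i \in Phi by rewrite -vE.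
  move=> /(Phi_red BP)[c1|c1]; first by rewrite vE c1 scale1r.
  by have := ler0n R (c i); rewrite c1 ler0N1.
Qed.

End BasedRootSystem.
(** * The root lattice as an even lattice *)

Section CartanMatrix.

Variables (R : realType) (V : vectType R) (ip : {dot V for idfun}).
Variables (Phi : seq V) (r : nat) (B : 'I_r -> V).
Hypotheses (Phi_root : root_system ip Phi) (Phi_red : reduced Phi).
Hypothesis B_simple : simple_basis Phi B.
Variable C : 'I_r -> 'I_r -> int.
Hypothesis BC : forall i j, cartan_number ip (B i) (B j) = (C i j)%:~R.

Let norm_gt0 i : 0 < ip (B i) (B i).
Proof. by apply: (root_norm_gt0 Phi_root); apply: (sb_root B_simple). Qed.

Lemma cartan_ip i j : 2 * ip (B i) (B j) = (C i j)%:~R * ip (B j) (B j).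
Proof. by rewrite -BC /cartan_number divfK // lt0r_neq0. Qed.

(** [d] symmetrizes the Cartan matrix along the edges of a spanning tree of the
    Dynkin diagram; [i0] is the root of the tree and [ht] decreases from a node
    to its parent. *)
Lemma connected_norms (d : 'I_r -> int) (i0 : 'I_r) (ht : 'I_r -> nat) :
  (forall i, 0 < d i) ->
  (forall i, i != i0 -> exists j,
     [/\ (ht j < ht i)%N, C i j != 0 & C i j * d j = C j i * d i]) ->
  exists2 kappa : R, 0 < kappa & forall i, ip (B i) (B i) = kappa * (2 * d i)%:~R.
Proof.
move=> d0 par; pose w i := ip (B i) (B i) / (2 * d i)%:~R.
have dR i : (2 * d i)%:~R != 0 :> R by rewrite intr_eq0 mulf_neq0 // lt0r_neq0.
have wE i : w i = w i0.
  have [n] := ubnP (ht i); elim: n i => // n IH i hi.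
  have [->//|/par[j [hj cij sym]]] := eqVneq i i0.
  rewrite -(IH j); last by rewrite ltnS in hi; apply: leq_trans hj hi.
  apply/eqP; rewrite /w eqr_div //; apply/eqP.
  have cR : (C i j)%:~R != 0 :> R by rewrite intr_eq0.
  apply: (mulfI cR).
  have e : (C i j)%:~R * ip (B j) (B j) = (C j i)%:~R * ip (B i) (B i).
    by rewrite -!cartan_ip ip_sym.
  have symR : (C i j)%:~R * (d j)%:~R = (C j i)%:~R * (d i)%:~R :> R.
    by rewrite -!intrM sym.
  rewrite [RHS]mulrA e !intrM.
  transitivity (ip (B i) (B i) * 2 * ((C i j)%:~R * (d j)%:~R)); first by ring.
  by rewrite symR; ring.
exists (w i0).
  by rewrite divr_gt0 // ltr0z mulr_gt0.
by move=> i; rewrite -(wE i) divfK.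
Qed.

Section Gram.

Variables (d : 'I_r -> int) (kappa : R).
Hypotheses (kappa_gt0 : 0 < kappa)
  (norms : forall i, ip (B i) (B i) = kappa * (2 * d i)%:~R).

(** The inner product in the basis [B], divided by [kappa]. *)
Definition gram (x y : 'rV[int]_r) : int :=
  \sum_i \sum_j x 0 i * y 0 j * (C i j * d j).

Lemma gram_ip x y : ip (emb B x) (emb B y) = kappa * (gram x y)%:~R.
Proof.
rewrite ip_suml rmorph_sum mulr_sumr; apply: eq_bigr => i _.
rewrite ip_Mzl ip_sym ip_suml rmorph_sum !mulr_sumr; apply: eq_bigr => j _.
have ipE : ip (B i) (B j) = kappa * (C i j * d j)%:~R.
  apply: (mulfI (_ : 2 != 0)); first by rewrite pnatr_eq0.
  by rewrite cartan_ip norms !intrM; ring.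
by rewrite ip_Mzl ip_sym ipE !intrM; ring.
Qed.

Let kappa_neq0 : kappa != 0 := lt0r_neq0 kappa_gt0.

Lemma gram_sym x y : gram x y = gram y x.
Proof.
by apply: (@intr_inj R); apply: (mulfI kappa_neq0); rewrite -!gram_ip ip_sym.
Qed.

Lemma gram_add x y z : gram (x + y) z = gram x z + gram y z.
Proof.
apply: (@intr_inj R); apply: (mulfI kappa_neq0).
by rewrite intrD mulrDr -!gram_ip raddfD linearDl.
Qed.

Lemma gram_pos x : x != 0 -> 0 < gram x x.
Proof.
move=> x0; rewrite -(ltr0z R) -(pmulr_rgt0 _ kappa_gt0) -gram_ip.
apply: neq0_dnorm_gt0; apply: contraNneq x0.
by move=> /(emb_eq0 B_simple) ->.
Qed.

Lemma gram_even x : (2 %| gram x x)%Z.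
Proof.
pose Q y := (2 %| gram y y)%Z.
have -> : x = \sum_i delta_mx 0 i *~ x 0 i.
  by rewrite {1}[x]row_sum_delta; apply: eq_bigr => i _; rewrite -scaler_int intz.
apply: (@big_ind _ Q); rewrite /Q.
- by rewrite /gram big1 ?dvdz0 // => i _; rewrite big1 // => j _; rewrite mxE !mul0r.
- move=> y z y2 z2; rewrite !(gram_add, gram_sym _ (_ + _)) (gram_sym z y).
  by move: y2 z2; clear; lia.
move=> i _; apply/dvdzP; exists (x 0 i * x 0 i * d i).
apply: (@intr_inj R); apply: (mulfI kappa_neq0).
rewrite -gram_ip raddfMz /= emb_delta ip_Mzl ip_sym ip_Mzl norms !intrM; ring.
Qed.

Lemma gram_lattice : lattice_form gram.
Proof.
split; [exact: gram_sym|exact: gram_add|exact: gram_pos|exact: gram_even].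
Qed.

Variable M : int.
Hypothesis dM : forall i, 2 * d i <= M.

Lemma gram_root x (c : 'I_r -> nat) : emb B x = \sum_i B i *+ c i ->
  emb B x \in Phi -> root gram M x.
Proof.
move=> xc xP.
have x0 : 0 < ip (emb B x) (emb B x) := root_norm_gt0 Phi_root xP.
split.
- by apply: contraTneq x0 => ->; rewrite raddf0 linear0l ltxx.
- rewrite -(ler_int R) -(ler_pM2l kappa_gt0) -gram_ip xc.
  apply: (positive_root_ind Phi_root Phi_red B_simple
    (Q := fun v => ip v v <= kappa * M%:~R)); last by rewrite -xc.
    by move=> i; rewrite norms ler_pM2l // ler_int.
  by move=> i v _; rewrite reflection_ip // lt0r_neq0.
- move=> y.
  have [m mE] : exists m : int, 2 * ip (emb B y) (emb B x) =
      m%:~R * ip (emb B x) (emb B x).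
    rewrite ip_suml mulr_sumr.
    apply: (big_ind (fun s => exists m : int, s = m%:~R * ip (emb B x) (emb B x))).
    + by exists 0; rewrite mul0r.
    + by move=> s t [m ->] [n ->]; exists (m + n); rewrite intrD mulrDl.
    + move=> i _; have [m mE] := cartan_int Phi_root (sb_root B_simple i) xP.
      exists (y 0 i * m); rewrite ip_Mzl intrM -mE /cartan_number.
      by field; rewrite lt0r_neq0.
  apply/dvdzP; exists m; apply: (@intr_inj R); apply: (mulfI kappa_neq0).
  rewrite !intrM mulrCA -gram_ip ip_sym mE gram_ip.
  by rewrite mulrCA.
Qed.

Theorem gram_unit_relation (I : finType) (x : I -> 'rV[int]_r) :
  [\/ M <= 2 /\ (r <= 8)%N, M <= 4 /\ (r <= 4)%N | M <= 6 /\ (r <= 2)%N] ->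
  (forall i, emb B (x i) \in Phi) ->
  (forall i, exists c : 'I_r -> nat, emb B (x i) = \sum_j B j *+ c j) ->
  dependent x -> unit_relation x.
Proof.
move=> small xP xpos; apply: (root_unit_relation gram_lattice _ small).
  by move=> J beta; exact: rank_dependent.
by move=> i; have [c xc] := xpos i; exact: gram_root xc (xP i).
Qed.

End Gram.
End CartanMatrix.
(** * Roots of types A, B, C, D as short integer vectors *)

Section SignedPermutations.

Variable N : nat.
Implicit Types (a b : 'I_N) (p q m : int) (x y : 'rV[int]_N).

Definition dot x y : int := \sum_c x 0 c * y 0 c.

(** All simple roots of types A, B, C, D have at most two nonzero
    coordinates. *)
Definition two_term a b p q : 'rV[int]_N := delta_mx 0 a *~ p + delta_mx 0 b *~ q.

Lemma two_termE a b p q c :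
  two_term a b p q 0 c = (c == a)%:Z * p + (c == b)%:Z * q.
Proof.
rewrite /two_term -!scaler_int !mxE !eqxx !intz /= ![_ * (_ : bool)%:R]mulrC.
by case: (c == a); case: (c == b).
Qed.

Lemma dot_suml (I : finType) (F : I -> 'rV[int]_N) (n : I -> int) y :
  dot (\sum_i F i *~ n i) y = \sum_i n i * dot (F i) y.
Proof.
rewrite /dot; under [RHS]eq_bigr do rewrite mulr_sumr.
rewrite exchange_big /=; apply: eq_bigr => c _; rewrite summxE mulr_suml.
by apply: eq_bigr => i _; rewrite -scaler_int mxE intz mulrA.
Qed.

Lemma dot_two_term x a b p q :
  dot x (two_term a b p q) = p * x 0 a + q * x 0 b.
Proof.
have S e : \sum_c x 0 c * (c == e)%:Z = x 0 e.
  rewrite (bigD1 e) //= eqxx mulr1 big1 ?addr0 // => c /negbTE ->.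
  by rewrite mulr0.
rewrite -(S a) -(S b) !mulr_sumr -big_split /=; apply: eq_bigr => c _.
by rewrite two_termE; ring.
Qed.

Definition short_two_term a b p q : Prop :=
  a != b /\ (`|p| = 1 /\ `|q| = 1 \/ `|p| <= 2 /\ p != 0 /\ q = 0).

Lemma l1norm_split2 x a b : a != b ->
  l1norm x = `|x 0 a| + `|x 0 b| + \sum_(c | (c != a) && (c != b)) `|x 0 c|.
Proof.
move=> ab; rewrite (l1norm_split _ a) (bigD1 b) 1?eq_sym //= addrA; congr (_ + _).
Qed.

Lemma l1norm_short a b p q : short_two_term a b p q ->
  l1norm (two_term a b p q) <= 2.
Proof.
move=> [ab pq]; rewrite (l1norm_split2 _ ab) big1 ?addr0 => [|c].
  rewrite !two_termE !eqxx (negbTE ab) eq_sym (negbTE ab) !mul1r !mul0r addr0 add0r.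
  by move: pq; clear; lia.
by case/andP => /negbTE ca /negbTE cb; rewrite two_termE ca cb !mul0r.
Qed.

(** The reflection in [e_a - e_b], [e_a + e_b] or a multiple of [e_a] is a
    signed permutation of the coordinates. *)
Lemma l1norm_reflect a b p q x m : short_two_term a b p q ->
  m * dot (two_term a b p q) (two_term a b p q) = 2 * dot x (two_term a b p q) ->
  l1norm (x - two_term a b p q *~ m) = l1norm x.
Proof.
move=> [ab pq].
rewrite !dot_two_term !two_termE !eqxx (negbTE ab) eq_sym (negbTE ab).
rewrite !mul1r !mul0r addr0 add0r !(l1norm_split2 _ ab) => mE.
have E c : (x - two_term a b p q *~ m) 0 c =
    x 0 c - m * ((c == a)%:Z * p + (c == b)%:Z * q).
  by rewrite -scaler_int 3!mxE two_termE intz.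
congr (_ + _); last first.
  apply: eq_bigr => c /andP[/negbTE ca /negbTE cb].
  by rewrite E ca cb !mul0r addr0 mulr0 subr0.
rewrite !E !eqxx (negbTE ab) eq_sym (negbTE ab) !mul1r !mul0r addr0 add0r.
move: mE; case: pq => [[p1 q1]|[_ [p0 ->]]] mE.
  have pE : p = 1 \/ p = -1 by move: p1; clear; lia.
  have qE : q = 1 \/ q = -1 by move: q1; clear; lia.
  by move: mE; case: pE => ->; case: qE => ->; clear; lia.
have mp : m * p = 2 * x 0 a.
  by apply: (mulfI p0); rewrite mulrCA mulr0 mul0r !addr0 in mE *; rewrite mE; ring.
by rewrite mp; clear; lia.
Qed.

End SignedPermutations.
Section SignedCoordinates.

Variables (R : realType) (V : vectType R) (ip : {dot V for idfun}).
Variables (Phi : seq V) (r : nat) (B : 'I_r -> V).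
Hypotheses (Phi_root : root_system ip Phi) (Phi_red : reduced Phi).
Hypothesis B_simple : simple_basis Phi B.
Variable C : 'I_r -> 'I_r -> int.
Hypothesis BC : forall i j, cartan_number ip (B i) (B j) = (C i j)%:~R.

Variables (N : nat) (a b : 'I_r -> 'I_N) (p q : 'I_r -> int).
Let s i := two_term (a i) (b i) (p i) (q i).
Hypothesis s_short : forall i, short_two_term (a i) (b i) (p i) (q i).
Hypothesis s_cartan :
  forall i j, 2 * dot (s i) (s j) = C i j * dot (s j) (s j).

Definition coords (x : 'rV[int]_r) : 'rV[int]_N := \sum_i s i *~ x 0 i.

Lemma coords_is_additive : zmod_morphism coords.
Proof.
move=> x y; rewrite /coords -sumrB; apply: eq_bigr => i _.
by rewrite !mxE mulrzBr.
Qed.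

HB.instance Definition _ :=
  GRing.isZmodMorphism.Build 'rV[int]_r 'rV[int]_N coords coords_is_additive.

Lemma coords_delta i : coords (delta_mx 0 i) = s i.
Proof.
rewrite /coords (bigD1 i) //= mxE !eqxx mulr1z big1 ?addr0 // => j /negbTE ji.
by rewrite mxE ji mulr0z.
Qed.

Let pairing (x : 'rV[int]_r) i : int := \sum_j x 0 j * C j i.

Lemma cartan_pairing x i : cartan_number ip (emb B x) (B i) = (pairing x i)%:~R.
Proof.
rewrite /cartan_number ip_suml mulr_sumr mulr_suml rmorph_sum /=.
apply: eq_bigr => j _; rewrite ip_Mzl intrM -BC /cartan_number.
by rewrite mulrCA !mulrA.
Qed.

Lemma dot_pairing x i :
  pairing x i * dot (s i) (s i) = 2 * dot (coords x) (s i).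
Proof.
rewrite /coords dot_suml mulr_sumr mulr_suml; apply: eq_bigr => j _.
by rewrite -mulrA -s_cartan mulrCA.
Qed.

Lemma dot_short_neq0 i : dot (s i) (s i) != 0.
Proof.
have [ab pq] := s_short i.
rewrite dot_two_term !two_termE !eqxx (negbTE ab) (eq_sym (b i)) (negbTE ab).
rewrite !mul1r !mul0r addr0 add0r.
by move: pq; clear; nia.
Qed.

(** A combination of simple roots whose coordinates vanish is orthogonal to all
    simple roots, since the Cartan matrix can be read off the coordinates. *)
Lemma coords_eq0 x : coords x = 0 -> x = 0.
Proof.
move=> x0; apply: (emb_eq0 B_simple); apply/eqP/negPn/negP => ex0.
have := neq0_dnorm_gt0 (s := ip) _ ex0.
rewrite {2}/emb ip_sym ip_suml big1 ?ltxx // => i _; rewrite ip_Mzl ip_sym.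
have px : pairing x i = 0.
  apply: (mulIf (dot_short_neq0 i)); rewrite dot_pairing x0 mul0r.
  by rewrite /dot big1 ?mulr0 // => c _; rewrite mxE mul0r.
have := cartan_pairing x i; rewrite px => /eqP.
have Bi0 := root_norm_gt0 Phi_root (sb_root B_simple i).
by rewrite mulf_eq0 invr_eq0 (gt_eqF Bi0) orbF mulf_eq0 pnatr_eq0 /=
  => /eqP ->; rewrite mulr0.
Qed.

Lemma coords_short x (c : 'I_r -> nat) : emb B x = \sum_i B i *+ c i ->
  emb B x \in Phi -> l1norm (coords x) <= 2.
Proof.
move=> xc xP.
have [|||y yx y2] := @positive_root_ind _ _ ip Phi r B Phi_root Phi_red B_simple
  (fun v => exists2 y, emb B y = v & l1norm (coords y) <= 2) _ _ c.
- move=> i; exists (delta_mx 0 i); first exact: emb_delta.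
  by rewrite coords_delta; apply: l1norm_short.
- move=> i _ _ [y <- y2]; exists (y - delta_mx 0 i *~ pairing y i).
    rewrite raddfB raddfMz /= emb_delta /reflection cartan_pairing.
    by rewrite scaler_int.
  rewrite raddfB raddfMz /= coords_delta l1norm_reflect //.
  exact: dot_pairing.
- by rewrite -xc.
by rewrite -xc in yx; rewrite -(emb_inj B_simple yx).
Qed.

Theorem coords_unit_relation (I : finType) (x : I -> 'rV[int]_r) :
  (forall i, emb B (x i) \in Phi) ->
  (forall i, exists c : 'I_r -> nat, emb B (x i) = \sum_j B j *+ c j) ->
  dependent x -> unit_relation x.
Proof.
move=> xP xpos [b0 [rb b00]].
have sumE b' : \sum_i coords (x i) *~ b' i = coords (\sum_i x i *~ b' i).
  by rewrite raddf_sum; apply: eq_bigr => i _; rewrite raddfMz.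
have [||b' [rb' u]] := @l1_unit_relation N I (fun i => coords (x i)).
- by move=> i; have [c xc] := xpos i; exact: coords_short xc (xP i).
- by exists b0; split=> //; rewrite /relation sumE rb raddf0.
exists b'; split=> //; apply: coords_eq0.
by rewrite -sumE.
Qed.

End SignedCoordinates.
(** * The individual types *)

Section Classical.

(** [((a, b), (p, q))] stands for the vector [p e_a + q e_b].  In types B and C
    the last simple root is [e_a] or [2 e_a]; its second index is a dummy one,
    so that [n + 1] coordinates serve for every type of rank [n]. *)
Definition classical_terms (X : simple_type) (i : nat) : (nat * nat) * (int * int) :=
  let ordinary := ((i, i.+1), (1, -1)) in
  match X with
  | TypeB n => if i.+1 == n then ((i, i.+1), (1, 0)) else ordinary
  | TypeC n => if i.+1 == n then ((i, i.+1), (2, 0)) else ordinary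
  | TypeD n => if i.+1 == n then ((i.-1, i), (1, 1)) else ordinary
  | _ => ordinary
  end.

Definition classical (X : simple_type) : bool :=
  match X with TypeA _ | TypeB _ | TypeC _ | TypeD _ => true | _ => false end.

Definition term_dot (s t : (nat * nat) * (int * int)) : int :=
  t.2.1 * ((t.1.1 == s.1.1)%:Z * s.2.1 + (t.1.1 == s.1.2)%:Z * s.2.2) +
  t.2.2 * ((t.1.2 == s.1.1)%:Z * s.2.1 + (t.1.2 == s.1.2)%:Z * s.2.2).

Lemma classical_terms_cartan X i j : valid_type X -> classical X ->
  (i < rank X)%N -> (j < rank X)%N ->
  2 * term_dot (classical_terms X i) (classical_terms X j) =
  cartan_entry X i j * term_dot (classical_terms X j) (classical_terms X j).
Proof.
case: X => //= n n2 _ iX jX; rewrite /cartan_entry /term_dot /chain /=.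
all: repeat (case: ifP => /= ?); lia.
Qed.

End Classical.
Section Assembly.

Variables (R : realType) (V : vectType R) (ip : {dot V for idfun}) (Phi : seq V).

Lemma simple_system_basis r (S : r.-tuple V) (s : {perm 'I_r}) :
  simple_system Phi S -> simple_basis Phi (fun i => tnth S (s i)).
Proof.
case=> Ssub Sbasis Ssign.
have reindexB (c : 'I_r -> nat) :
    \sum_i tnth S i *+ c i = \sum_i tnth S (s i) *+ c (s i).
  by rewrite (reindex_inj (@perm_inj _ s)).
split.
- by move=> i; apply: Ssub; exact: mem_tnth.
- move=> c c0 i.
  have /freeP/(_ (fun j => c (s^-1%g j))) := basis_free Sbasis.
  move=> /(_ _ (s i)); rewrite permK; apply.
  rewrite (reindex_inj (@perm_inj _ s)) /= -[RHS]c0; apply: eq_bigr => j _.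
  by rewrite permK -tnth_nth.
- by move=> v /Ssign[] [c ->]; [left|right]; exists (fun i => c (s i)).
Qed.

Variables (r : nat) (B : 'I_r -> V).
Hypothesis B_simple : simple_basis Phi B.

(** The rank of a rational matrix does not change over the reals. *)
Lemma not_free_dependent k (alpha : k.-tuple V) (x : 'I_k -> 'rV[int]_r) :
  (forall i, tnth alpha i = emb B (x i)) -> ~~ free alpha -> dependent x.
Proof.
move=> alphaE; move/negP=> nfree; apply: ratmx_dependent; apply/negP => rf.
apply: nfree; apply/freeP => c c0 i.
pose XR : 'M[R]_(k, r) := map_mx ratr (ratmx x).
have XRE t j : XR t j = (x t 0 j)%:~R by rewrite !mxE ratr_int.
have rfR : row_free XR by rewrite row_free_map.
have cX : (\row_t c t) *m XR = 0.
  apply/rowP => j; rewrite !mxE; move: j.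
  apply: (sb_free B_simple (c := fun j => _)).
  rewrite -[RHS]c0.
  under eq_bigr do rewrite scaler_suml.
  rewrite exchange_big /=; apply: eq_bigr => t _.
  rewrite -tnth_nth alphaE scaler_sumr; apply: eq_bigr => j _.
  by rewrite mxE XRE -scaler_int scalerA.
have /rowP/(_ i) : \row_t c t = 0.
  by apply: (row_free_inj rfR); rewrite mul0mx.
by rewrite !mxE.
Qed.

End Assembly.

Section Types.

Variables (R : realType) (V : vectType R) (ip : {dot V for idfun}) (Phi : seq V).
Hypotheses (Phi_root : root_system ip Phi) (Phi_red : reduced Phi).

Lemma dot_two_term2 N (a b a' b' : 'I_N) p q p' q' :
  dot (two_term a b p q) (two_term a' b' p' q') =
  p' * ((a' == a)%:Z * p + (a' == b)%:Z * q) +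
  q' * ((b' == a)%:Z * p + (b' == b)%:Z * q).
Proof. by rewrite dot_two_term !two_termE. Qed.

Section FixedType.

Variables (X : simple_type) (X_valid : valid_type X).
Variable B : 'I_(rank X) -> V.
Hypothesis B_simple : simple_basis Phi B.
Hypothesis BX : forall i j, cartan_number ip (B i) (B j) = (cartan_entry X i j)%:~R.
Variables (I : finType) (x : I -> 'rV[int]_(rank X)).
Hypotheses (xP : forall i, emb B (x i) \in Phi)
  (xpos : forall i, exists c : 'I_(rank X) -> nat,
     emb B (x i) = \sum_j B j *+ c j).

Lemma classical_unit_relation : classical X -> dependent x -> unit_relation x.
Proof.
move=> Xc.
pose n := rank X; pose t (i : 'I_n) := classical_terms X i.
have tb (i : 'I_n) : [/\ ((t i).1.1 <= n)%N, ((t i).1.2 <= n)%N,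
    (t i).1.1 != (t i).1.2 & `|(t i).2.1| = 1 /\ `|(t i).2.2| = 1 \/
      `|(t i).2.1| <= 2 /\ (t i).2.1 != 0 /\ (t i).2.2 = 0].
  have := ltn_ord i; move: X_valid Xc; rewrite /t /n; clear.
  move: (nat_of_ord i) => {}i.
  case: X => //= m mv _ im; repeat (case: ifP => /= ?); split; lia.
have inordE (u v : nat) : (u <= n)%N -> (v <= n)%N ->
    (inord u == inord v :> 'I_n.+1) = (u == v).
  by move=> un vn; rewrite -val_eqE /= !inordK.
apply: (coords_unit_relation Phi_root Phi_red B_simple BX
  (a := fun i => inord (t i).1.1 : 'I_n.+1) (b := fun i => inord (t i).1.2)
  (p := fun i => (t i).2.1) (q := fun i => (t i).2.2)) => //.
- by move=> i; have [h1 h2 h3 h4] := tb i; split; rewrite ?inordE.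
- move=> i j; have [h1 h2 _ _] := tb i; have [h3 h4 _ _] := tb j.
  rewrite !dot_two_term2 !inordE //.
  exact: (classical_terms_cartan X_valid Xc (ltn_ord i) (ltn_ord j)).
Qed.

Lemma symmetrizable_unit_relation (d ht : nat -> nat) (i0 : 'I_(rank X)) (M : nat) :
  [\/ (M <= 2)%N /\ (rank X <= 8)%N, (M <= 4)%N /\ (rank X <= 4)%N
    | (M <= 6)%N /\ (rank X <= 2)%N] ->
  (forall i, (i < rank X)%N -> (0 < d i)%N /\ (2 * d i <= M)%N) ->
  (forall i : nat, (i < rank X)%N -> i != i0 -> exists j : nat,
     [/\ (j < rank X)%N, (ht j < ht i)%N, cartan_entry X i j != 0
       & cartan_entry X i j * (d j)%:Z = cartan_entry X j i * (d i)%:Z]) ->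
  dependent x -> unit_relation x.
Proof.
move=> small dM par.
have [||kappa k0 norms] := connected_norms Phi_root B_simple BX
    (d := fun i => (d i)%:Z) (i0 := i0) (ht := fun i => ht i).
- by move=> i; have [d0 _] := dM i (ltn_ord i).
- move=> i ii0; have [j [jX h c e]] := par i (ltn_ord i) ii0.
  by exists (Ordinal jX).
apply: (gram_unit_relation Phi_root Phi_red B_simple BX k0 norms (M := M%:Z)) => //.
by move=> i; have [_] := dM i (ltn_ord i).
Qed.

End FixedType.
End Types.
Lemma simple_type_unit_relation (R : realType) (V : vectType R)
    (ip : {dot V for idfun}) (Phi : seq V) (X : simple_type)
    (B : 'I_(rank X) -> V) (I : finType) (x : I -> 'rV[int]_(rank X)) :
  root_system ip Phi -> reduced Phi -> valid_type X -> simple_basis Phi B ->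
  (forall i j, cartan_number ip (B i) (B j) = (cartan_entry X i j)%:~R) ->
  (forall i, emb B (x i) \in Phi) ->
  (forall i, exists c : 'I_(rank X) -> nat, emb B (x i) = \sum_j B j *+ c j) ->
  dependent x -> unit_relation x.
Proof.
move=> Phi_root Phi_red X_valid B_simple BX xP xpos.
have [|X_exc] := boolP (classical X).
  exact: (classical_unit_relation Phi_root Phi_red X_valid B_simple BX xP xpos).
have := symmetrizable_unit_relation Phi_root Phi_red B_simple BX xP xpos.
(* The trees for type E are rooted at the branch node 3, with [par6] giving the
   parent of a node; those for F4 and G2 are paths rooted at 0. *)
pose ht6 k := nth 0%N [:: 2; 1; 1; 0; 1; 2; 3; 4]%N k.
pose par6 k := nth 0%N [:: 2; 3; 3; 0; 3; 4; 5; 6]%N k.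
case: X X_valid X_exc B x B_simple BX xP xpos => //= _ _ B x _ _ _ _ main.
- apply: (main (fun=> 1%N) ht6 (inord 3) 2%N); first by apply: Or31.
    by [].
  move=> i i6; rewrite inordK // => i3; exists (par6 i).
  by move: i i6 i3; do 6! [case=> //].
- apply: (main (fun=> 1%N) ht6 (inord 3) 2%N); first by apply: Or31.
    by [].
  move=> i i6; rewrite inordK // => i3; exists (par6 i).
  by move: i i6 i3; do 7! [case=> //].
- apply: (main (fun=> 1%N) ht6 (inord 3) 2%N); first by apply: Or31.
    by [].
  move=> i i6; rewrite inordK // => i3; exists (par6 i).
  by move: i i6 i3; do 8! [case=> //].
- apply: (main (fun k => if (k < 2)%N then 2%N else 1%N) id ord0 4%N).
  + by apply: Or32.
  + by move=> i; case: ifP.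
  + by move=> i i4 i0; exists i.-1; move: i i4 i0; do 4! [case=> //].
- apply: (main (fun k => if (k < 1)%N then 1%N else 3%N) id ord0 6%N).
  + by apply: Or33.
  + by move=> i; case: ifP.
  + by move=> i i2 i0; exists i.-1; move: i i2 i0; do 2! [case=> //].
Qed.

Unset Implicit Arguments.
Set Strict Implicit.
Set Printing Implicit Defensive.

Theorem lemma5p2 (R : realType) (V : vectType R) (ip : {dot V for idfun})
    (Phi : seq V) (Phi_root : root_system ip Phi) (Phi_red : reduced Phi)
    (Phi_irr : irreducible ip Phi)
    (X : simple_type) (X_valid : valid_type X)
    (S : (rank X).-tuple V) (S_simple : simple_system Phi S)
    (S_type : has_type ip S)
    (k : nat) (alpha : k.-tuple V)
    (alpha_pos : forall i : 'I_k, positive_root Phi S (tnth alpha i))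
    (alpha_dep : ~~ free alpha) :
  exists a : 'I_k -> int,
    \sum_(i < k) tnth alpha i *~ a i = 0 /\
    exists j : 'I_k, a j = 1 \/ a j = -1.
Proof.
have [s sC] := S_type; pose B i := tnth S (s i).
have B_simple : simple_basis Phi B := simple_system_basis s S_simple.
have coord i : exists c : 'I_(rank X) -> nat, tnth alpha i = \sum_j B j *+ c j.
  have [_ [c ->]] := alpha_pos i; exists (fun j => c (s j)).
  by rewrite (reindex_inj (@perm_inj _ s)).
have [c cE] := choice coord.
pose x i : 'rV[int]_(rank X) := \row_j (c i j)%:Z.
have xE i : tnth alpha i = emb B (x i) by rewrite cE emb_nat.
have [|i|b [rb [j bj]]] := simple_type_unit_relation Phi_root Phi_red X_valid
    B_simple sC (x := x) _ _ (not_free_dependent B_simple xE alpha_dep).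
- by move=> i; rewrite -xE; case: (alpha_pos i).
- by rewrite -xE; exact: coord.
exists b; split; last by exists j; lia.
under eq_bigr do rewrite xE.
by rewrite relation_emb rb raddf0.
Qed.
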